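(* Let $d\ge1$, $\beta,\gamma\in(-1,\infty)^d$, $\beta\ne\gamma$, $\sigma_1,\sigma_2>0$, and for some $\lambda\in(0,1)$ let $$\alpha=\lambda\beta+(1-\lambda)\gamma,\qquad \sigma=\lambda\sigma_1+(1-\lambda)\sigma_2.$$ Then, uniformly in $t>0$ and $x,y\in\mathbb{R}^d_+$, $$G_t^\alpha(x,y)\simeq\big(G_t^\beta(x,y)\big)^\lambda\big(G_t^\gamma(x,y)\big)^{1-\lambda},$$ and, uniformly in $x,y\in\mathbb{R}^d_+$, $$\mathcal{K}^{\alpha,\sigma}(x,y)\lesssim\big(\mathcal{K}^{\beta,\sigma_1}(x,y)\big)^\lambda\big(\mathcal{K}^{\gamma,\sigma_2}(x,y)\big)^{1-\lambda}.$$ Moreover, for $f=f_1^\lambda f_2^{1-\lambda}$ with (measurable) $f_1,f_2\ge0$ on $\mathbb{R}^d_+$, $$\mathcal{I}^{\alpha,\sigma}f(x)\lesssim\big(\mathcal{I}^{\beta,\sigma_1}f_1(x)\big)^\lambda\big(\mathcal{I}^{\gamma,\sigma_2}f_2(x)\big)^{1-\lambda},\qquad x\in\mathbb{R}^d_+,$$ with the implicit constant independent of $x$, $f_1$, $f_2$.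
   Context: $\mathbb{R}^d_+=(0,\infty)^d$, $\mathbb{N}=\{0,1,\ldots\}$, $|k|=\sum k_i$, $|\alpha|=\sum\alpha_i$. $X\lesssim Y$ means $X\le CY$ with a positive constant $C$ independent of the variables; $X\simeq Y$ means $X\lesssim Y$ and $Y\lesssim X$. For $\alpha\in(-1,\infty)^d$ let $\mu_\alpha(dx)=x_1^{2\alpha_1+1}\cdots x_d^{2\alpha_d+1}\,dx$ on $\mathbb{R}^d_+$. The Laguerre functions of convolution type are $\ell_k^\alpha(x)=\prod_{i=1}^d\ell_{k_i}^{\alpha_i}(x_i)$, $k\in\mathbb{N}^d$, where $$\ell_{k_i}^{\alpha_i}(x_i)=\Big(\frac{2\Gamma(k_i+1)}{\Gamma(k_i+\alpha_i+1)}\Big)^{1/2}L_{k_i}^{\alpha_i}(x_i^2)e^{-x_i^2/2}$$ and $L_m^\nu$ is the Laguerre polynomial of degree $m$ and order $\nu$. Define $$G_t^{\alpha}(x,y)=\sum_{k\in\mathbb{N}^d}e^{-t(4|k|+2|\alpha|+2d)}\ell_k^\alpha(x)\ell_k^\alpha(y),\qquad \mathcal{K}^{\alpha,\sigma}(x,y)=\frac1{\Gamma(\sigma)}\int_0^\infty G_t^{\alpha}(x,y)t^{\sigma-1}\,dt,$$ $$\mathcal{I}^{\alpha,\sigma}f(x)=\int_{\mathbb{R}^d_+}\mathcal{K}^{\alpha,\sigma}(x,y)f(y)\,d\mu_\alpha(y).$$ It is known that $G_t^\alpha(x,y)>0$; for nonnegative $f$ the quantities $\mathcal{K}^{\alpha,\sigma}(x,y)$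 and $\mathcal{I}^{\alpha,\sigma}f(x)$ are understood as elements of $[0,\infty]$ (with $0\cdot\infty=0$). *)

(* Defs.v *)
From HB Require Import structures.
From mathcomp Require Import all_boot all_order all_algebra.
From mathcomp Require Import all_classical all_reals all_analysis.
From mathcomp.analysis.showcase Require summability.

Set Implicit Arguments.
Unset Strict Implicit.
Unset Printing Implicit Defensive.

Import Order.TTheory GRing.Theory Num.Theory.
Import numFieldNormedType.Exports.

Local Open Scope classical_set_scope.
Local Open Scope ring_scope.

Definition tuple_cons {T : Type} n (p : T * n.-tuple T) : n.+1.-tuple T :=
  [tuple of p.1 :: p.2].

Section tuple_measure.
Context d (T : measurableType d) (R : realType).
Local Open Scope ereal_scope.

Fixpoint tuple_measure (m : set T -> \bar R) n : set (n.-tuple T) -> \bar R :=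
  match n return set (n.-tuple T) -> \bar R with
  | 0%N => \d_[tuple]
  | n.+1 => pushforward (m \x @tuple_measure m n) (@tuple_cons T n)
  end.
Arguments tuple_measure : clear implicits.

Lemma measurable_tuple_cons n : measurable_fun setT (@tuple_cons T n).
Proof. exact: measurable_cons. Qed.

Variable m : {sigma_finite_measure set T -> \bar R}.

Let tuple_cons_sigma_finite n
    (nu : {sigma_finite_measure set (n.-tuple T) -> \bar R}) :
  exists mu : {sigma_finite_measure set (n.+1.-tuple T) -> \bar R},
    pushforward (m \x nu) (@tuple_cons T n) = mu.
Proof.
move mcE : (pushforward _ _) => mc.
have mc0 : mc set0 = 0 by rewrite -mcE /pushforward preimage_set0 measure0.
have mc_ge0 A : 0 <= mc A by rewrite -mcE /pushforward measure_ge0.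
have mcS : semi_sigma_additive mc.
  move=> F mF tF mUF; rewrite -mcE /pushforward preimage_bigcup.
  apply: measure_semi_sigma_additive.
  - by move=> i; rewrite -[X in measurable X]setTI; exact: measurable_tuple_cons.
  - apply/trivIsetP => /= i j _ _ ij; rewrite -preimage_setI.
    by move/trivIsetP : tF => /(_ _ _ _ _ ij) ->//; rewrite preimage_set0.
  - rewrite -preimage_bigcup -[X in measurable X]setTI.
    exact: measurable_tuple_cons.
pose mcM := isMeasure.Build _ _ _ mc mc0 mc_ge0 mcS.
pose mu : {measure set (n.+1.-tuple T) -> \bar R} := HB.pack mc mcM.
pose uncons (t : n.+1.-tuple T) : (T * n.-tuple T)%type :=
  (thead t, [tuple of behead t]).
have consK : cancel (@tuple_cons T n) uncons.
  move=> [x t]; rewrite /uncons /tuple_cons /= theadE; congr pair.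
  exact/val_inj.
have unconsm : measurable_fun setT uncons.
  apply: measurable_fun_pair; last exact: measurable_behead.
  exact: measurable_tnth.
have mcF : sigma_finite setT mc.
  have /sigma_finiteP[F [FT ndF Foo]] := sigma_finiteT m.
  have /sigma_finiteP[G [GT ndG Goo]] := sigma_finiteT nu.
  exists (fun i => uncons @^-1` (F i `*` G i)).
    rewrite -preimage_bigcup; apply/esym/seteqP; split => // t _ /=.
    have [i _ Fi] : (\bigcup_i F i) (thead t) by rewrite -FT.
    have [j _ Gj] : (\bigcup_j G j) [tuple of behead t] by rewrite -GT.
    exists (maxn i j) => //; split.
      by move: Fi; exact/subsetPset/ndF/leq_maxl.
    by move: Gj; exact/subsetPset/ndG/leq_maxr.
  move=> i; have [mF Fi] := Foo i; have [mG Gi] := Goo i; split.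
    by rewrite -[X in measurable X]setTI; apply: unconsm => //; exact: measurableX.
  rewrite -mcE /pushforward -comp_preimage (_ : uncons \o _ = id); last first.
    by apply/funext => p /=; exact: consK.
  by rewrite preimage_id product_measure1E// lte_mul_pinfty// ge0_fin_numE.
pose mcSF := Measure_isSigmaFinite.Build _ _ _ mu mcF.
by exists (HB.pack_for {sigma_finite_measure set (n.+1.-tuple T) -> \bar R}
  mc mcM mcSF).
Qed.

Let tuple_measureE n :
  exists mu : {sigma_finite_measure set (n.-tuple T) -> \bar R},
    tuple_measure m n = mu.
Proof.
elim: n => [|n [nu IH]]; last by rewrite /= IH; exact: tuple_cons_sigma_finite.
by exists [the {sigma_finite_measure set _ -> \bar R} of \d_[tuple]].
Qed.

Let tuple_measure0 n : tuple_measure m n set0 = 0.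
Proof. by have [mu ->] := tuple_measureE n; exact: measure0. Qed.

Let tuple_measure_ge0 n A : 0 <= tuple_measure m n A.
Proof. by have [mu ->] := tuple_measureE n; exact: measure_ge0. Qed.

Let tuple_measure_sigma_additive n : semi_sigma_additive (tuple_measure m n).
Proof.
by have [mu ->] := tuple_measureE n; exact: measure_semi_sigma_additive.
Qed.

HB.instance Definition _ n := isMeasure.Build _ _ _ (tuple_measure m n)
  (tuple_measure0 n) (@tuple_measure_ge0 n) (@tuple_measure_sigma_additive n).

Let tuple_measure_sigma_finite n : sigma_finite setT (tuple_measure m n).
Proof. by have [mu ->] := tuple_measureE n; exact: sigma_finiteT. Qed.

HB.instance Definition _ n := Measure_isSigmaFinite.Build _ _ _
  (tuple_measure m n) (@tuple_measure_sigma_finite n).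

End tuple_measure.
Arguments tuple_measure {d T R} m n _.

Section laguerre.
Context {R : realType}.

Definition Gamma (s : R) : R :=
  \int[lebesgue_measure]_(u in `]0, +oo[) (u `^ (s - 1) * expR (- u)).

Definition gbinomial (a : R) (k : nat) : R :=
  (\prod_(j < k) (a - j%:R)) / k`!%:R.

Definition laguerre (nu : R) (m : nat) : {poly R} :=
  \poly_(i < m.+1)
    ((-1) ^+ i * gbinomial (m%:R + nu) (m - i) / i`!%:R).

Definition ell1 (nu : R) (m : nat) (x : R) : R :=
  Num.sqrt (2 * Gamma (m%:R + 1) / Gamma (m%:R + nu + 1)) *
  (laguerre nu m).[x ^+ 2] * expR (- (x ^+ 2 / 2)).

Variable d : nat.
Implicit Types (alpha : 'rV[R]_d) (k : {ffun 'I_d -> nat}).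

(* Points of R^d are tuples and not row vectors because only the former carry
   a sigma-algebra (the product one) in the library. *)
Implicit Types x y : d.-tuple (measurableTypeR R).

Definition ell alpha k x : R := \prod_(i < d) ell1 (alpha 0 i) (k i) (tnth x i).

Definition orthant : set (d.-tuple (measurableTypeR R)) :=
  [set x | forall i, 0 < tnth x i :> R].

(* [summability.sum] is the limit over the finite sets of indices ordered by
   inclusion; the multiple series converges absolutely. *)
Definition heat_kernel alpha (t : R) x y : R :=
  summability.sum (fun k : {ffun 'I_d -> nat} =>
    expR (- t * (4 * (\sum_(i < d) k i)%N%:R + 2 * (\sum_(i < d) alpha 0 i)
                 + 2 * d%:R)) *
    ell alpha k x * ell alpha k y : R^o).

Definition potential_kernel alpha (sigma : R) x y : \bar R :=
  ((Gamma sigma)^-1%:E *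
   \int[lebesgue_measure]_(t in `]0%R, +oo[)
     (heat_kernel alpha t x y * t `^ (sigma - 1))%:E)%E.

(* density of mu_alpha with respect to the Lebesgue measure *)
Definition mu_density alpha x : R :=
  \prod_(i < d) (tnth x i : R) `^ (2 * alpha 0 i + 1).

Definition potential_op alpha (sigma : R) (f : d.-tuple (measurableTypeR R) -> R) x
    : \bar R :=
  (\int[tuple_measure lebesgue_measure d]_(y in orthant)
     (potential_kernel alpha sigma x y * (f y)%:E * (mu_density alpha y)%:E))%E.

End laguerre.
Arguments orthant {R d}.

(* Main.v *)
Require Import Defs.
From mathcomp Require Import all_boot all_order all_algebra.
From mathcomp Require Import all_classical all_reals all_analysis.
From mathcomp Require Import finmap measurable_realfun zify ring lra.
From mathcomp.analysis.showcase Require summability.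
Import Order.TTheory GRing.Theory Num.Theory.
Import numFieldNormedType.Exports.
Local Open Scope classical_set_scope.
Local Open Scope ring_scope.

(* By the Hille-Hardy formula the heat kernel is a product over the coordinates
   of one-dimensional kernels which depend on the order alpha only through a
   factor c(alpha) D^(alpha + 1), with D independent of alpha, and through the
   entire function H_A(z) = sum_n z^n / (n! (A)_n) with A = alpha + 1. The first
   factor interpolates exactly, and H_B(z) is comparable to
   (1 + z)^((A - B) / 2) H_A(z) uniformly in z >= 0, because the terms of the
   series of H_A concentrate at n of order sqrt z: since
   n (n + A - 1) p_n = z p_(n-1) for p_n = z^n / (n! (A)_n), all moments
   sum_n p_n ((n + 1)^2 / (1 + z))^m, m an integer, are bounded by a constant
   times H_A(z). This gives the two-sided estimate of the heat kernels; the
   estimates of the potential kernels and operators follow from it by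
   Hoelder's inequality.
   The Hille-Hardy formula itself is proved by expanding its right-hand side
   into an absolutely convergent quadruple series and regrouping the terms; the
   coefficients match by the Pfaff-Saalschuetz identity. *)

Set Implicit Arguments.
Unset Strict Implicit.
Unset Printing Implicit Defensive.

(** * Unconditional summation *)

(** Asymptotics of Bessel functions are avoided. Since [(A)_n / (B)_n] is at most a constant times
    [(n + 1)^(A - B)], passing from order A to order B weights the n-th term of [H_A] by
    [(1 + z)^s u^s], up to a constant, with [u = (n + 1)^2 / (1 + z)] and [s = (A - B) / 2]; for an
    integer [m >= |s|], [u^s <= u^m + u^(-m)] leaves only integer moments. One upper bound is
    enough, because exchanging A and B gives the lower one. For [A = lambda B + (1 - lambda) G] the
    exponents [lambda (B - A) / 2] and [(1 - lambda) (G - A) / 2] of [1 + z] add up to 0, which is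
    why both directions of the interpolation hold. The heat kernel is a limit over finite sets of
    multi-indices, with terms that may change sign, so factoring it over the coordinates requires
    absolute convergence in each of them. This is inherited from the quadruple series: the absolute
    values of its terms form a series of the same kind, with a known sum. [Gamma] enters through the
    normalisation of the Laguerre functions; its functional equation turns these constants into
    Pochhammer symbols. *)

Section has_sum.
Context {R : realType}.
Local Notation "A `<=` B" := (fsubset A B).
Local Notation "A `|` B" := (fsetU A B).

(** Convergence along the finite sets ordered by inclusion. Unlike the value [summability.sum], it
    asserts that the limit exists. *)
Definition has_sum {I : choiceType} (f : I -> R) (s : R) :=
  forall e, 0 < e -> exists A : {fset I}, forall B : {fset I},
    A `<=` B -> `|\sum_(i <- B) f i - s| < e.

Definition abs_sum_le {I : choiceType} (f : I -> R) (M : R) :=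
  forall A : {fset I}, \sum_(i <- A) `|f i| <= M.

Lemma has_sum_summability (I : choiceType) (f : I -> R) s :
  has_sum f s -> summability.sum (f : I -> R^o) = s.
Proof.
move=> fs; have FF := @summability.totally_filter I.
apply: (cvg_lim (@norm_hausdorff _ _)).
apply/(@cvgrPdist_lt R R^o) => e e0; have [A AP] := fs e e0.
exists A => // B /= AB; rewrite distrC /summability.partial_sum.
by rewrite -(big_seq_fsetE _ _ xpredT f) /=; exact: AP.
Qed.

Lemma has_sum_unique (I : choiceType) (f : I -> R) s1 s2 :
  has_sum f s1 -> has_sum f s2 -> s1 = s2.
Proof. by move=> /has_sum_summability <- /has_sum_summability <-. Qed.

Lemma eq_has_sum (I : choiceType) (f g : I -> R) s :
  f =1 g -> has_sum f s -> has_sum g s.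
Proof. by move=> /funext ->. Qed.

Lemma has_sum0 (I : choiceType) : has_sum (fun _ : I => 0 : R) 0.
Proof. by move=> e e0; exists fset0 => B _; rewrite big1// subrr normr0. Qed.

Lemma has_sumD (I : choiceType) (f g : I -> R) a b :
  has_sum f a -> has_sum g b -> has_sum (fun i => f i + g i) (a + b).
Proof.
move=> fa gb e e0; have e20 : 0 < e / 2 by rewrite divr_gt0.
have [A AP] := fa _ e20; have [B BP] := gb _ e20.
exists (A `|` B) => C; rewrite fsubUset => /andP[AC BC].
rewrite big_split/= opprD addrACA (splitr e).
by rewrite (le_lt_trans (ler_normD _ _))// ltrD// ?AP ?BP.
Qed.

Lemma has_sumZ (I : choiceType) (f : I -> R) a c :
  has_sum f a -> has_sum (fun i => c * f i) (c * a).
Proof.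
move=> fa e e0; have [|A AP] := fa (e / (`|c| + 1)).
  by rewrite divr_gt0// ltr_wpDl.
exists A => B /AP; rewrite ltr_pdivlMr ?ltr_wpDl// => h.
rewrite -mulr_sumr -mulrBr normrM (le_lt_trans _ h)// mulrC.
by rewrite ler_wpM2l// lerDl.
Qed.

Lemma has_sum_bigsum (I J : choiceType) (r : seq J) (f : J -> I -> R) (a : J -> R) :
  (forall j, has_sum (f j) (a j)) ->
  has_sum (fun i => \sum_(j <- r) f j i) (\sum_(j <- r) a j).
Proof.
move=> fa; elim: r => [|j r IH].
  by rewrite big_nil; apply: eq_has_sum (has_sum0 _) => i; rewrite big_nil.
rewrite big_cons; apply: eq_has_sum (has_sumD (fa j) IH) => i.
by rewrite big_cons.
Qed.

Lemma ler_sum_fsubset (I : choiceType) (f : I -> R) (A B : {fset I}) :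
  (forall i, 0 <= f i) -> A `<=` B -> \sum_(i <- A) f i <= \sum_(i <- B) f i.
Proof.
move=> f0 AB; rewrite (big_fsetID _ (mem A) B)/= -[leLHS]addr0 lerD//.
  rewrite le_eqVlt; apply/orP; left; apply/eqP; congr (\sum_(i <- _) _); congr enum_fset.
  by apply/fsetP => i; rewrite !inE/=; apply/idP/andP => [iA|[]//]; split=> //; exact: (fsubsetP AB).
by rewrite sumr_ge0.
Qed.

Lemma has_sum_ge0_le (I : choiceType) (f : I -> R) s (A : {fset I}) :
  (forall i, 0 <= f i) -> has_sum f s -> \sum_(i <- A) f i <= s.
Proof.
move=> f0 fs; apply/ler_addgt0Pr => e e0; have [B BP] := fs e e0.
have := BP _ (fsubsetUr A B); rewrite ltr_norml => /andP[_ /ltW].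
rewrite lerBlDl => h; apply: le_trans h.
exact/ler_sum_fsubset/fsubsetUl.
Qed.

Lemma has_sum_abs_sum_le (I : choiceType) (f : I -> R) s :
  (forall i, 0 <= f i) -> has_sum f s -> abs_sum_le f s.
Proof.
move=> f0 fs A; under eq_bigr do rewrite ger0_norm//.
exact: has_sum_ge0_le.
Qed.

Lemma has_sum_le_bound (I : choiceType) (f : I -> R) s M :
  has_sum f s -> (forall A : {fset I}, \sum_(i <- A) f i <= M) -> s <= M.
Proof.
move=> fs fM; apply/ler_addgt0Pr => e e0; have [B BP] := fs e e0.
have := BP _ (fsubset_refl B); rewrite ltr_norml => /andP[+ _].
rewrite ltrBrDl ltrBlDr => /ltW/le_trans; apply.
by rewrite lerD2r.
Qed.

(** The sum is the supremum of the finite partial sums. *)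
Lemma nneg_has_sum (I : choiceType) (f : I -> R) M :
  (forall i, 0 <= f i) -> (forall A : {fset I}, \sum_(i <- A) f i <= M) ->
  exists s, has_sum f s.
Proof.
move=> f0 fM; pose S := [set \sum_(i <- A) f i | A in [set: {fset I}]].
have hs : has_sup S.
  by split; [exists (\sum_(i <- fset0) f i), fset0|exists M => _ [A _ <-]].
exists (sup S) => e e0; have [_ [A _ <-] Ae] := sup_adherent e0 hs.
exists A => B AB; rewrite ltr_norml; apply/andP; split.
  by rewrite ltrBrDr addrC (lt_le_trans Ae)// ler_sum_fsubset.
rewrite ltrBlDr (@le_lt_trans _ _ (sup S)) ?ltrDr//.
by apply: sup_ubound; [case: hs|exists B].
Qed.

(** Writes [f] as [(|f| + f) - |f|], a difference of two nonnegative families with bounded partial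
    sums. *)
Lemma abs_sum_le_has_sum (I : choiceType) (f : I -> R) M :
  abs_sum_le f M -> exists s, has_sum f s.
Proof.
move=> fM; have [s1 s1P] : exists s, has_sum (fun i => `|f i|) s.
  exact: nneg_has_sum fM.
have [|A|s2 s2P] := @nneg_has_sum _ (fun i => `|f i| + f i) (M + M).
- by move=> i; rewrite -lerBlDr sub0r -normrN ler_norm.
- rewrite big_split/= lerD//; apply: le_trans (fM A).
  by apply: ler_sum => i _; exact: ler_norm.
exists (s2 + -1 * s1).
apply: eq_has_sum (has_sumD s2P (has_sumZ (-1) s1P)) => i.
by rewrite mulN1r addrAC subrr add0r.
Qed.

Lemma big_imfset_inj (I J : choiceType) (h : I -> J) (F : J -> R) (A : {fset I}) :
  injective h -> \sum_(j <- [fset h i | i in A]%fset) F j = \sum_(i <- A) F (h i).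
Proof. by move=> hi; rewrite big_imfset//= => x y _ _; exact: hi. Qed.

Lemma has_sum_reindex (I J : choiceType) (h : I -> J) (g : J -> R) s :
  injective h -> (forall j, g j != 0 -> exists i, j = h i) ->
  has_sum (g \o h) s -> has_sum g s.
Proof.
move=> hi gh fs e e0; have [A AP] := fs e e0.
exists [fset h i | i in A]%fset => B AB.
(* The preimage of [B] under [h] is finite by injectivity; indices of [B] outside the range of [h]
   contribute 0. *)
have [C' C'P] : exists C : {fset I}, forall i, (i \in C) = (h i \in B).
  have fin : finite_set [set i | h i \in B].
    apply: finite_preimage (finite_fset B).
    by move=> x y _ _; exact: hi.
  exists (fset_set [set i | h i \in B]) => i.
  by rewrite in_fset_set//; apply/idP/idP => [/set_mem|?]//; exact/mem_set.
have -> : \sum_(j <- B) g j = \sum_(i <- C') (g \o h) i.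
  rewrite -(big_imfset_inj g _ hi) (big_fsetID _ (mem [fset h i | i in C']%fset) B)/=.
  rewrite [X in _ + X]big_seq_cond [X in _ + X]big1 ?addr0; last first.
    move=> j /andP[]; rewrite !inE/= => /andP[jB njh] _.
    apply/eqP/negPn/negP => /gh[i ji]; move/negP : njh; apply.
    by apply/imfsetP; exists i => //=; rewrite C'P -ji.
  congr (\sum_(i <- _) _); congr enum_fset; apply/fsetP => j; rewrite !inE/=.
  apply/andP/idP => [[]//|jC]; split => //.
  by move/imfsetP : jC => [i /= + ->]; rewrite C'P.
apply: AP; apply/fsubsetP => i iA; rewrite C'P.
by apply: (fsubsetP AB); apply/imfsetP; exists i.
Qed.

Lemma big_fsetM (I J : choiceType) (F : I * J -> R) (A : {fset I}) (B : {fset J}) :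
  \sum_(p <- fsetM A B) F p = \sum_(i <- A) \sum_(j <- B) F (i, j).
Proof.
rewrite -big_allpairs; apply/perm_big/uniq_perm; rewrite ?fset_uniq//.
  by apply: allpairs_uniq; rewrite ?fset_uniq// => -[? ?] [? ?].
move=> [i j]; rewrite in_fsetM/=; apply/andP/allpairsP => [[iA jB]|].
  by exists (i, j).
by move=> [[? ?] /= [iA jB [-> ->]]].
Qed.

(** The sum of [g] over a finite [B] is a limit of sums of [F] over rectangles [B x D]; when [B] and
    [D] contain the projections of [A], the rectangle contains [A] and its sum is within [e / 2] of
    [s]. *)
Lemma has_sum_fubini (I J : choiceType) (F : I * J -> R) g s :
  has_sum F s -> (forall i, has_sum (fun j => F (i, j)) (g i)) -> has_sum g s.
Proof.
move=> Fs Fg e e0; have e20 : 0 < e / 2 by rewrite divr_gt0.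
have [A AP] := Fs _ e20.
exists [fset p.1 | p in A]%fset => B AB.
have [C CP] := has_sum_bigsum B Fg e20.
pose D := (C `|` [fset p.2 | p in A])%fset.
have /CP := fsubsetUl C [fset p.2 | p in A]%fset.
have -> : \sum_(j <- D) \sum_(i <- B) F (i, j) = \sum_(p <- fsetM B D) F p.
  by rewrite exchange_big/= big_fsetM.
have /AP : A `<=` fsetM B D.
  apply/fsubsetP => -[i j] ijA; rewrite in_fsetM/=; apply/andP; split.
    by apply: (fsubsetP AB); apply/imfsetP; exists (i, j).
  by rewrite inE; apply/orP; right; apply/imfsetP; exists (i, j).
move=> h1 h2; rewrite (splitr e) (le_lt_trans _ (ltrD h2 h1))//.
by rewrite [X in _ <= X + _]distrC (le_trans _ (ler_normD _ _))// addrA subrK.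
Qed.

(** Every finite set of pairs lies in the rectangle spanned by its two projections. *)
Lemma abs_sum_le_fubini (I J : choiceType) (F : I * J -> R) G M :
  (forall i, abs_sum_le (fun j => F (i, j)) (G i)) ->
  (forall A : {fset I}, \sum_(i <- A) G i <= M) -> abs_sum_le F M.
Proof.
move=> FG GM A; pose B := [fset p.1 | p in A]%fset; pose D := [fset p.2 | p in A]%fset.
have AB : A `<=` fsetM B D.
  by apply/fsubsetP => -[i j] ijA; rewrite in_fsetM/=; apply/andP; split;
    apply/imfsetP; exists (i, j).
apply: le_trans (ler_sum_fsubset _ AB) _ => //.
rewrite big_fsetM/=; apply: le_trans (GM B).
by apply: ler_sum => i _; exact: FG.
Qed.

(** Converse of [has_sum_fubini]: the absolute bound provides some sum of [F], and uniqueness of the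
    sum of [g] identifies it. *)
Lemma has_sum_rows (I J : choiceType) (F : I * J -> R) g s M :
  abs_sum_le F M -> (forall i, has_sum (fun j => F (i, j)) (g i)) ->
  has_sum g s -> has_sum F s.
Proof.
move=> /abs_sum_le_has_sum[s' Fs'] Fg gs.
by rewrite -(has_sum_unique (has_sum_fubini Fs' Fg) gs).
Qed.

Lemma abs_sum_le_prod (I J : choiceType) (f : I -> R) (g : J -> R) M N :
  abs_sum_le f M -> abs_sum_le g N -> abs_sum_le (fun p => f p.1 * g p.2) (M * N).
Proof.
move=> fM gN; apply: (@abs_sum_le_fubini _ _ _ (fun i => `|f i| * N)).
  move=> i A /=; under eq_bigr do rewrite normrM.
  by rewrite -mulr_sumr ler_wpM2l.
move=> A; rewrite -mulr_suml ler_wpM2r//.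
by have := gN fset0; rewrite big_nil.
Qed.

Lemma has_sum_prod (I J : choiceType) (f : I -> R) (g : J -> R) a b M N :
  abs_sum_le f M -> abs_sum_le g N -> has_sum f a -> has_sum g b ->
  has_sum (fun p => f p.1 * g p.2) (a * b).
Proof.
move=> fM gN fa gb; apply: (has_sum_rows (abs_sum_le_prod fM gN)).
  by move=> i /=; apply: has_sumZ gb.
by rewrite mulrC; apply: eq_has_sum (has_sumZ b fa) => i; rewrite mulrC.
Qed.

Lemma sum_fset_iota (f : nat -> R) n :
  \sum_(i <- [fset i in iota 0 n]%fset) f i = \sum_(0 <= i < n) f i.
Proof.
rewrite /index_iota subn0; apply/perm_big/uniq_perm; rewrite ?fset_uniq ?iota_uniq//.
by move=> i; rewrite inE.
Qed.

Lemma has_sum_nat_finite (f : nat -> R) N :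
  (forall n, (N <= n)%N -> f n = 0) -> has_sum f (\sum_(i < N) f i).
Proof.
move=> f0 e e0; exists [fset i in iota 0 N]%fset => B AB.
suff -> : \sum_(i <- B) f i = \sum_(i < N) f i by rewrite subrr normr0.
rewrite (big_fsetID _ (mem [fset i in iota 0 N]%fset) B)/=.
rewrite [X in _ + X]big_seq_cond [X in _ + X]big1 ?addr0; last first.
  move=> j /andP[]; rewrite !inE/= mem_iota add0n/= -leqNgt => /andP[_ /f0//].
rewrite -(big_mkord xpredT f) -sum_fset_iota.
rewrite (_ : [fset x in B | _]%fset = [fset i in iota 0 N]%fset); last first.
  apply/fsetP => i; apply/idP/idP; rewrite !inE/=; first by case/andP.
  by move=> h; rewrite h andbT; apply: (fsubsetP AB); rewrite inE/=.
by [].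
Qed.

Lemma has_sum_series (f : nat -> R) s :
  has_sum f s -> series f @ \oo --> s.
Proof.
move=> fs; apply/cvgrPdist_lt => e e0; have [A AP] := fs e e0.
near=> n; rewrite distrC.
have -> : series f n = \sum_(i <- [fset i in iota 0 n]%fset) f i.
  by rewrite sum_fset_iota.
apply: AP; apply/fsubsetP => i iA; rewrite inE/= mem_iota/= add0n.
have : (i <= \max_(j <- A) j)%N by exact: leq_bigmax_seq.
move/leq_ltn_trans; apply; near: n.
exact: nbhs_infty_gt.
Unshelve. all: by end_near. Qed.

Lemma abs_series_has_sum (f : nat -> R) s M :
  abs_sum_le f M -> series f @ \oo --> s -> has_sum f s.
Proof.
move=> fM fs; have [s' fs'] := abs_sum_le_has_sum fM.
suff -> : s = s' by [].
exact: cvg_unique fs (has_sum_series fs').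
Qed.

Lemma sum_fset_le_nat (f : nat -> R) M : (forall n, 0 <= f n) ->
  (forall N, \sum_(i < N) f i <= M) -> forall A : {fset nat}, \sum_(i <- A) f i <= M.
Proof.
move=> f0 fM A; apply: le_trans (fM (\max_(j <- A) j).+1).
rewrite -(big_mkord xpredT f) -sum_fset_iota.
apply: ler_sum_fsubset => //; apply/fsubsetP => i iA.
by rewrite in_fset mem_iota add0n ltnS leq_bigmax_seq.
Qed.

Lemma nneg_series_has_sum (f : nat -> R) s : (forall n, 0 <= f n) ->
  series f @ \oo --> s -> has_sum f s.
Proof.
move=> f0 fs; apply: (@abs_series_has_sum _ _ s) => //.
move=> A; under eq_bigr do rewrite ger0_norm//.
apply: sum_fset_le_nat => // N; rewrite -(big_mkord xpredT f).
rewrite -(cvg_lim (@Rhausdorff _) fs).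
apply: nondecreasing_cvgn_le; last by apply/cvg_ex; exists s.
exact: nondecreasing_series.
Qed.

End has_sum.

(** * Sums over multi-indices *)

Section has_sum_ffun.
Context {R : realType}.

Lemma has_sum_norm_abs_sum_le (I : choiceType) (f : I -> R) s :
  has_sum (fun i => `|f i|) s -> abs_sum_le f s.
Proof. by move=> fs A; exact: has_sum_ge0_le. Qed.

(** Induction on [d] through the product of two sums. The sum of the absolute values is part of the
    conclusion because the next product needs an absolute bound. *)
Lemma has_sum_bigprod (d : nat) (f : 'I_d -> nat -> R) (a b : 'I_d -> R) :
  (forall i, has_sum (f i) (a i)) -> (forall i, has_sum (fun n => `|f i n|) (b i)) ->
  has_sum (fun k : {ffun 'I_d -> nat} => \prod_(i < d) f i (k i)) (\prod_(i < d) a i)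
  /\ has_sum (fun k : {ffun 'I_d -> nat} => `|\prod_(i < d) f i (k i)|) (\prod_(i < d) b i).
Proof.
elim: d f a b => [|d IH] f a b fa fb.
  have H : has_sum (fun k : {ffun 'I_0 -> nat} => 1 : R) 1.
    move=> e e0; pose k0 : {ffun 'I_0 -> nat} := [ffun=> 0%N].
    have kE (k : {ffun 'I_0 -> nat}) : k = k0 by apply/ffunP => -[].
    exists [fset k0]%fset => B; rewrite fsub1set => k0B.
    suff -> : B = [fset k0]%fset by rewrite big_seq_fset1 subrr normr0.
    by apply/fsetP => k; rewrite (kE k) k0B inE eqxx.
  by rewrite !big_ord0; split; apply: eq_has_sum H => k; rewrite big_ord0// normr1.
(* [h] prepends a first coordinate; it is the bijection that turns a sum over pairs into one over
   multi-indices of length [d + 1]. *)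
pose h (p : nat * {ffun 'I_d -> nat}) : {ffun 'I_d.+1 -> nat} :=
  [ffun i => if unlift ord0 i is Some j then p.2 j else p.1].
have h0 p : h p ord0 = p.1 by rewrite ffunE unlift_none.
have hS p j : h p (lift ord0 j) = p.2 j by rewrite ffunE liftK.
have hi : injective h.
  move=> [n k] [n' k'] e; congr (_, _).
    by have := h0 (n, k); rewrite e h0.
  by apply/ffunP => j; have := hS (n, k) j; rewrite e hS.
have hs k : exists p, k = h p.
  exists (k ord0, [ffun j => k (lift ord0 j)]); apply/ffunP => i.
  case: (unliftP ord0 i) => [j|] ->; last by rewrite h0.
  by rewrite hS ffunE.
have [] := IH (fun i => f (lift ord0 i)) (fun i => a (lift ord0 i))
  (fun i => b (lift ord0 i)) (fun i => fa (lift ord0 i)) (fun i => fb (lift ord0 i)).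
move=> Ha Hb.
have P1 := has_sum_norm_abs_sum_le (fb ord0).
have P2 := has_sum_norm_abs_sum_le Hb.
have P1' := has_sum_abs_sum_le (fun n => normr_ge0 _) (fb ord0).
have P2' := has_sum_abs_sum_le (fun n => normr_ge0 _) Hb.
rewrite !big_ord_recl; split; apply: (has_sum_reindex hi) => [k _|].
- exact: hs.
- apply: eq_has_sum (has_sum_prod P1 P2 (fa ord0) Ha) => p /=.
  by rewrite big_ord_recl h0; under [in RHS]eq_bigr do rewrite hS.
- exact: hs.
- apply: eq_has_sum (has_sum_prod P1' P2' (fb ord0) Hb) => p /=.
  by rewrite big_ord_recl normrM h0; under [in RHS]eq_bigr do rewrite hS.
Qed.
End has_sum_ffun.

(** * Absolutely convergent sums *)

Section abs_has_sum.
Context {R : realType}.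

Definition abs_has_sum {I : choiceType} (f : I -> R) (s : R) :=
  has_sum f s /\ exists M, abs_sum_le f M.

Lemma eq_abs_has_sum (I : choiceType) (f g : I -> R) s :
  f =1 g -> abs_has_sum f s -> abs_has_sum g s.
Proof. by move=> /funext ->. Qed.

Lemma abs_has_sumZ (I : choiceType) (f : I -> R) c s :
  abs_has_sum f s -> abs_has_sum (fun i => c * f i) (c * s).
Proof.
move=> [fs [M fM]]; split; first exact: has_sumZ.
exists (`|c| * M) => A; under eq_bigr do rewrite normrM.
by rewrite -mulr_sumr ler_wpM2l.
Qed.

Lemma abs_has_sum_prod (I J : choiceType) (f : I -> R) (g : J -> R) a b :
  abs_has_sum f a -> abs_has_sum g b ->
  abs_has_sum (fun p => f p.1 * g p.2) (a * b).
Proof.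
move=> [fa [M fM]] [gb [N gN]]; split; first exact: has_sum_prod fM gN fa gb.
by exists (M * N); exact: abs_sum_le_prod.
Qed.

Lemma abs_has_sum_reindex (I J : choiceType) (h : I -> J) (g : J -> R) s :
  injective h -> (forall j, g j != 0 -> exists i, j = h i) ->
  abs_has_sum (g \o h) s -> abs_has_sum g s.
Proof.
move=> hi gh [fs [M fM]]; split; first exact: has_sum_reindex gh fs.
have [t ft] := nneg_has_sum (fun i => normr_ge0 ((g \o h) i)) fM.
exists t => A; apply: has_sum_ge0_le => //.
by apply: has_sum_reindex hi _ ft => j; rewrite normr_eq0; exact: gh.
Qed.

Lemma abs_has_sum_fubini (I J : choiceType) (F : I * J -> R) g s :
  abs_has_sum F s -> (forall i, has_sum (fun j => F (i, j)) (g i)) ->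
  abs_has_sum g s.
Proof.
move=> [Fs [M FM]] Fg; split; first exact: has_sum_fubini Fs Fg.
exists M => A.
(* With [|g i| = sg (g i) * g i], the finite sum of the [|g i|] becomes a limit of finite sums over
   the columns of [sg (g i) * F (i, j)], each of which is at most [M]. *)
have := has_sum_bigsum A (fun i => has_sumZ (Num.sg (g i)) (Fg i)).
under eq_bigr do rewrite -normrEsg.
move=> /has_sum_le_bound; apply => C.
apply: le_trans (FM (fsetM A C)); rewrite big_fsetM exchange_big/=.
apply: ler_sum => i _; apply: ler_sum => j _.
apply: le_trans (ler_norm _) _; rewrite normrM ler_piMl//.
by rewrite normr_sg; case: (_ != 0).
Qed.

Lemma abs_has_sum_rows (I J : choiceType) (F : I * J -> R) g G s :
  (forall i, has_sum (fun j => F (i, j)) (g i)) ->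
  (forall i, has_sum (fun j => `|F (i, j)|) (G i)) ->
  abs_has_sum g s -> (exists M, abs_sum_le G M) -> abs_has_sum F s.
Proof.
move=> Fg FG [gs _] [M GM]; have FM : abs_sum_le F M.
  apply: (@abs_sum_le_fubini _ _ _ _ G) => [i A|A].
    by apply: has_sum_ge0_le => //; exact: FG.
  by apply: le_trans (GM A); apply: ler_sum => i _; exact: ler_norm.
by split; [exact: has_sum_rows FM Fg gs|exists M].
Qed.

Lemma abs_has_sum_bigprod (d : nat) (f : 'I_d -> nat -> R) (a : 'I_d -> R) :
  (forall i, abs_has_sum (f i) (a i)) ->
  has_sum (fun k : {ffun 'I_d -> nat} => \prod_(i < d) f i (k i)) (\prod_(i < d) a i).
Proof.
move=> fa; have /choice[b fb] : forall i, exists s, has_sum (fun n => `|f i n|) s.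
  by move=> i; have [_ [M fM]] := fa i; exact: nneg_has_sum fM.
by have [] := has_sum_bigprod (fun i => (fa i).1) fb.
Qed.

End abs_has_sum.

(** * The Gamma function *)

Section gamma_function.
Context {R : realType}.
Local Notation mu := (@lebesgue_measure R).
Local Notation I_ n := `[(n.+1%:R^-1 : R)%R, (n.+1%:R : R)%R]%classic.
Implicit Types (s u a b : R).

Lemma integral_derive_itv (f F : R -> R) a b : 0 < a -> a < b ->
  (forall u, 0 < u -> is_derive u 1 F (f u)) ->
  (forall u, 0 < u -> {for u, continuous f}) ->
  (\int[mu]_(u in `[a, b]) (f u)%:E = (F b - F a)%:E)%E.
Proof.
move=> a0 ab dF cf; rewrite EFinB.
have cF u : 0 < u -> {for u, continuous F}.
  by move=> u0; apply: differentiable_continuous; apply/derivable1_diffP; have [] := dF u u0.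
have b0 : 0 < b by exact: lt_trans ab.
apply: continuous_FTC2 => //.
- apply: continuous_in_subspaceT => u /set_mem/=; rewrite in_itv/= => /andP[au _].
  by apply: cf; exact: lt_le_trans au.
- split.
  + by move=> u; rewrite in_itv/= => /andP[au _]; have [] := dF u (lt_trans a0 au).
  + by apply: cvg_at_right_filter; exact: cF.
  + by apply: cvg_at_left_filter; exact: cF.
- move=> u; rewrite in_itv/= => /andP[au _]; rewrite derive1E.
  by have [] := dF u (lt_trans a0 au).
Qed.

(** Monotone convergence along compact intervals that avoid 0, on which the fundamental theorem of
    calculus is available. The interval for [n = 0] is the single point 1 and has to be treated
    apart later. *)
Lemma integral_itv0y_cvg (f : R -> R) : (forall u, 0 < u -> 0 <= f u) ->
  measurable_fun setT f ->
  (\int[mu]_(u in I_ n) (f u)%:E @[n --> \oo] -->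
   \int[mu]_(u in `]0%R, +oo[) (f u)%:E)%E.
Proof.
move=> f0 mf.
have -> : `]0%R, +oo[%classic = \bigcup_n I_ n.
  apply/seteqP; split => u /=.
    rewrite in_itv/= andbT => u0.
    exists (maxn (Num.truncn u^-1) (Num.truncn u)) => //=; rewrite in_itv/=.
    apply/andP; split.
      rewrite invf_ple ?posrE//; apply: le_trans (ltW (truncnS_gt _)) _.
      by rewrite ler_nat ltnS leq_maxl.
    apply: le_trans (ltW (truncnS_gt _)) _.
    by rewrite ler_nat ltnS leq_maxr.
  move=> [n _]; rewrite /= !in_itv/= andbT => /andP[+ _].
  by apply: lt_le_trans; rewrite invr_gt0.
apply: ge0_nondecreasing_set_cvg_integral => //.
- apply/nondecreasing_seqP => n; rewrite subsetEset; apply: subset_itv => //=;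
    rewrite bnd_simp ?lef_pV2 ?posrE// ler_nat//.
- by move=> n; apply/measurable_EFinP; exact: measurable_funTS.
- move=> n u; rewrite /= in_itv/= => /andP[+ _] => h.
  by rewrite lee_fin f0// (lt_le_trans _ h)// invr_gt0.
Qed.

Definition gamma_int s u : R := u `^ (s - 1) * expR (- u).

Lemma gamma_int_ge0 s u : 0 <= gamma_int s u.
Proof. by rewrite mulr_ge0 ?powR_ge0 ?expR_ge0. Qed.

Lemma measurable_gamma_int s : measurable_fun setT (gamma_int s).
Proof.
apply: measurable_funM; first exact: measurable_powR.
apply: (measurableT_comp (@measurable_expR R)).
exact: oppr_measurable.
Qed.

Lemma continuous_gamma_int s u : 0 < u -> {for u, continuous (gamma_int s)}.
Proof.
move=> u0; apply: differentiable_continuous; apply/derivable1_diffP.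
by apply: derivableM; [case: (is_derive1_powR (s - 1) u0)|exact: ex_derive].
Qed.

(** Raises [1 + u <= (s + 1) (1 + u / (s + 1)) <= (s + 1) exp (u / (s + 1))] to the power
    [s + 1]. *)
Lemma powR_le_expR s u : 0 < s -> 0 < u -> (1 + u) `^ (s + 1) <= (s + 1) `^ (s + 1) * expR u.
Proof.
move=> s0 u0; have s10 : 0 < s + 1 by rewrite addr_gt0.
have -> : expR u = expR (u / (s + 1)) `^ (s + 1) by rewrite -expRM divfK// gt_eqF.
rewrite -powRM ?expR_ge0 ?(ltW s10)//.
rewrite ge0_ler_powR ?nnegrE ?mulr_ge0 ?expR_ge0 ?addr_ge0 ?(ltW s0) ?(ltW u0)//.
apply: le_trans (ler_wpM2l (ltW s10) (expR_ge1Dx _)).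
by rewrite mulrDr mulr1 mulrCA divff ?gt_eqF// mulr1 lerD2r lerDr ltW.
Qed.

(* The integrand is dominated by a multiple of the derivative of (u / (1 + u))^s. *)
Lemma gamma_integral_bounded s : 0 < s -> exists M : R, forall n : nat,
  (\int[mu]_(u in I_ n) (gamma_int s u)%:E <= M%:E)%E.
Proof.
move=> s0.
pose F u := (u * (1 + u)^-1) `^ s.
pose f u := s * (u * (1 + u)^-1) `^ (s - 1) * (1 + u)^-2.
have dF u : 0 < u -> is_derive u 1 F (f u).
  move=> u0; have u10 : 0 < 1 + u by rewrite addr_gt0.
  have h0 : 0 < u * (1 + u)^-1 by rewrite divr_gt0.
  have h1 : is_derive u 1 (fun u : R => (1 + u)^-1) (- (1 + u) ^- 2 *: (0 + 1)).
    by apply: is_deriveV; rewrite gt_eqF.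
  have h2 : is_derive u 1 (fun u : R => u * (1 + u)^-1) ((1 + u) ^- 2).
    apply: (is_derive_eq (is_deriveM (is_derive_id u 1) h1)); rewrite /GRing.scale/=.
    by field; rewrite gt_eqF.
  exact: (is_derive1_comp (f := (@powR R)^~ s) (g := fun u : R => u * (1 + u)^-1)
    (is_derive1_powR s h0) h2).
have cf u : 0 < u -> {for u, continuous f}.
  move=> u0; have u10 : 0 < 1 + u by rewrite addr_gt0.
  have h0 : 0 < u * (1 + u)^-1 by rewrite divr_gt0.
  apply: differentiable_continuous; apply/derivable1_diffP.
  have h1 : is_derive u 1 (fun u : R => (1 + u)^-1) (- (1 + u) ^- 2 *: (0 + 1)).
    by apply: is_deriveV; rewrite gt_eqF.
  have h2 : derivable (fun u : R => u * (1 + u)^-1) u 1 by exact: ex_derive.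
  apply: derivableM.
    apply: derivableM; first exact: derivable_cst.
    have := is_derive1_comp (f := (@powR R)^~ (s - 1)) (g := fun u : R => u * (1 + u)^-1)
      (is_derive1_powR (s - 1) h0) (derivableP h2).
    by case.
  apply: derivableV; first by rewrite expf_neq0// gt_eqF.
  exact: ex_derive.
(* Since [f u = s u^(s - 1) (1 + u)^(-(s + 1))], the domination by [C * f] reduces to
   [powR_le_expR]. As [F] takes values in [0, 1], the integral of [C * f] is at most [C]. *)
pose C := (s + 1) `^ (s + 1) / s.
have C0 : 0 <= C by rewrite divr_ge0 ?powR_ge0 ?ltW.
have gf u : 0 < u -> gamma_int s u <= C * f u.
  move=> u0; have u10 : 0 < 1 + u by rewrite addr_gt0.
  have -> : C * f u = u `^ (s - 1) * ((s + 1) `^ (s + 1) * (1 + u) `^ (- (s + 1))).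
    rewrite /C /f powRM ?invr_ge0 ?ltW// -[(1 + u)^-1]powR_inv1 ?ltW// -powRrM.
    rewrite -(@powR_invn _ (1 + u) 2) ?ltW//.
    have -> : - (s + 1) = (-1 * (s - 1)) + (- 2%:R) by ring.
    rewrite [(1 + u) `^ (_ - _)]powRD ?(gt_eqF u10) ?implybT//.
    by field; rewrite gt_eqF.
  rewrite /gamma_int ler_wpM2l ?powR_ge0// powRN expRN.
  rewrite ler_pdivlMr ?powR_gt0// mulrC -ler_pdivlMr ?invr_gt0 ?expR_gt0// invrK.
  exact: powR_le_expR.
have f_ge0 u : 0 < u -> 0 <= f u.
  by move=> u0; rewrite !mulr_ge0 ?powR_ge0 ?(ltW s0)// invr_ge0 exprn_ge0// addr_ge0 ?(ltW u0).
exists C => n.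
case: n => [|n].
  by rewrite invr1 set_itv1 integral_set1 ?lee_fin.
have n0 : (0 : R) < n.+2%:R^-1 by rewrite invr_gt0.
have nn : (n.+2%:R^-1 : R) < n.+2%:R by rewrite (@lt_trans _ _ 1) ?invf_lt1 ?ltr1n.
apply: (@le_trans _ _ (\int[mu]_(u in I_ n.+1) (C * f u)%:E)%E).
  apply: ge0_le_integral => //.
  - by move=> u _; rewrite lee_fin gamma_int_ge0.
  - by apply/measurable_EFinP; apply: measurable_funTS; exact: measurable_gamma_int.
  - apply/measurable_EFinP; apply: measurable_funM => //.
    apply: subspace_continuous_measurable_fun => //.
    apply: continuous_in_subspaceT => u /set_mem/=; rewrite in_itv/= => /andP[au _].
    by apply: cf; exact: lt_le_trans au.
  - move=> u; rewrite /= in_itv/= => /andP[au _].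
    by rewrite lee_fin gf// (lt_le_trans _ au).
under eq_integral do rewrite EFinM.
have mf : measurable_fun (I_ n.+1) (EFin \o f).
  apply/measurable_EFinP; apply: subspace_continuous_measurable_fun => //.
  apply: continuous_in_subspaceT => u /set_mem/=; rewrite in_itv/= => /andP[au _].
  by apply: cf; exact: lt_le_trans au.
have fpos u : I_ n.+1 u -> (0 <= (f u)%:E)%E.
  rewrite /= in_itv/= => /andP[au _].
  by rewrite lee_fin f_ge0// (lt_le_trans _ au).
rewrite ge0_integralZl_EFin//.
rewrite (integral_derive_itv n0 nn dF cf) -EFinM lee_fin ler_piMr//.
rewrite lerBlDr (@le_trans _ _ 1) ?lerDl ?powR_ge0// /F.
have a01 : 0 < (n.+2%:R : R) * (1 + n.+2%:R)^-1 <= 1.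
  by rewrite divr_gt0 ?addr_gt0//= ler_pdivrMr ?addr_gt0// mul1r lerDr.
by have := ger_powR a01 (ltW s0); rewrite powRr0.
Qed.

(** [Gamma] is the real part of an extended integral, a meaningless default if that integral is
    infinite; the bound uniform in [n] excludes this. *)
Lemma Gamma_cvg s : 0 < s -> (\int[mu]_(u in I_ n) (gamma_int s u)%:E
   @[n --> \oo] --> (Gamma s)%:E)%E /\
   (Gamma s)%:E = (\int[mu]_(u in `]0%R, +oo[) (gamma_int s u)%:E)%E.
Proof.
move=> s0; have [M HM] := gamma_integral_bounded s0.
have H := integral_itv0y_cvg (fun u _ => gamma_int_ge0 s u) (measurable_gamma_int s).
suff -> : (Gamma s)%:E = (\int[mu]_(u in `]0%R, +oo[) (gamma_int s u)%:E)%E by [].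
rewrite /Gamma /Rintegral fineK//; apply/fin_numPlt/andP; split.
  by rewrite (@lt_le_trans _ _ 0%E)//; apply: integral_ge0 => u _; rewrite lee_fin gamma_int_ge0.
apply: (@le_lt_trans _ _ M%:E); last exact: ltry.
by apply: cvge_to_le H _; exact: nearW.
Qed.

Lemma Gamma_gt0 s : 0 < s -> 0 < Gamma s.
Proof.
move=> s0; rewrite -lte_fin (Gamma_cvg s0).2.
(* On [1, 2], [u^(s - 1) >= u^(-1) >= 1/2] and [exp (- u) >= exp (- 2)]. *)
pose c : R := 2^-1 * expR (- 2).
have c0 : 0 < c by rewrite mulr_gt0 ?expR_gt0.
apply: (@lt_le_trans _ _ (\int[mu]_(u in `[1%R, 2%R]) c%:E)%E).
  by rewrite integral_cst//= lebesgue_measure_itv/= lte_fin ltr1n -EFinB mule_gt0// lte_fin; lra.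
apply: (@le_trans _ _ (\int[mu]_(u in `[1%R, 2%R]) (gamma_int s u)%:E)%E).
  apply: ge0_le_integral => //.
  - by move=> u _; rewrite lee_fin ltW.
  - by apply/measurable_EFinP; apply: measurable_funTS; exact: measurable_gamma_int.
  - move=> u; rewrite /= in_itv/= => /andP[u1 u2]; have u0 : 0 < u by exact: lt_le_trans u1.
    rewrite lee_fin ler_pM ?invr_ge0 ?expR_ge0//; last by rewrite ler_expR lerN2.
    apply: (@le_trans _ _ u^-1); first by rewrite lef_pV2 ?posrE.
    by rewrite -(powR_inv1 (ltW u0)) ler_powR// lerDr ltW.
apply: ge0_subset_integral => //.
- by apply/measurable_EFinP; apply: measurable_funTS; exact: measurable_gamma_int.
- by move=> u _; rewrite lee_fin gamma_int_ge0.
- by apply: subset_itv => //; rewrite bnd_simp.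
Qed.

Lemma integrable_gamma_int s n : mu.-integrable (I_ n) (EFin \o gamma_int s).
Proof.
apply: continuous_compact_integrable; first exact: segment_compact.
apply: continuous_in_subspaceT => u /set_mem/=; rewrite in_itv/= => /andP[au _].
by apply: continuous_gamma_int; apply: lt_le_trans au; rewrite invr_gt0.
Qed.

Lemma Gamma_Rcvg s : 0 < s ->
  \int[mu]_(u in I_ n) gamma_int s u @[n --> \oo] --> Gamma s.
Proof.
move=> s0; have [+ _] := Gamma_cvg s0.
by move/fine_cvg.
Qed.

(** These are the boundary terms of the integration by parts in [GammaS]. At the upper end
    [powR_le_expR] bounds the term by a constant over [n + 1]; at the lower end [u^s] tends to 0. *)
Lemma powR_expRN_harmonic_cvg0 s : 0 < s ->
  n.+1%:R `^ s * expR (- n.+1%:R) - n.+1%:R^-1 `^ s * expR (- n.+1%:R^-1)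
    @[n --> \oo] --> (0 : R).
Proof.
move=> s0; rewrite -[0 in X in _ --> X](subr0 0); apply: cvgB.
  pose C := (s + 1) `^ (s + 1).
  have Ch : C * harmonic n @[n --> \oo] --> (0 : R).
    by rewrite -(mulr0 C); apply: cvgMr; exact: cvg_harmonic.
  apply: (squeeze_cvgr _ (cvg_cst 0) Ch).
  - apply: nearW => n; rewrite mulr_ge0 ?powR_ge0 ?expR_ge0//=.
    have n0 : (0 : R) < n.+1%:R by [].
    have := powR_le_expR s0 n0; rewrite -/C => h.
    rewrite expRN ler_pdivlMr// mulrAC ler_pdivrMr ?expR_gt0//.
    apply: le_trans h; rewrite -[X in _ * X]powRr1// -powRD ?pnatr_eq0 ?implybT//.
    by rewrite ge0_ler_powR ?nnegrE ?addr_ge0 ?(ltW s0)// lerDr.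
have hs : harmonic n `^ s @[n --> \oo] --> (0 : R).
  have /cvg_at_rightP := powR_cvg0 s0; apply; split; first exact: harmonic_gt0.
  exact: cvg_harmonic.
apply: (squeeze_cvgr _ (cvg_cst 0) hs).
- apply: nearW => n; rewrite mulr_ge0 ?powR_ge0 ?expR_ge0//=.
  by rewrite ler_piMr ?powR_ge0// -expR0 ler_expR oppr_le0.
Qed.

Lemma GammaS s : 0 < s -> Gamma (s + 1) = s * Gamma s.
Proof.
move=> s0; have s10 : 0 < s + 1 by rewrite addr_gt0.
apply/esym/eqP; rewrite -subr_eq0; apply/eqP.
pose f u := s * gamma_int s u - gamma_int (s + 1) u.
have H n : s * (\int[mu]_(u in I_ n) gamma_int s u) - (\int[mu]_(u in I_ n) gamma_int (s + 1) u)
   = n.+1%:R `^ s * expR (- n.+1%:R) - n.+1%:R^-1 `^ s * expR (- n.+1%:R^-1).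
  rewrite -RintegralZl//; last exact: integrable_gamma_int.
  rewrite -RintegralB//; last 2 first.
  - apply: (integrableZl _ s (integrable_gamma_int s n)) => //; exact: integrable_gamma_int.
  - exact: integrable_gamma_int.
  case: n => [|n].
    by rewrite invr1 set_itv1 Rintegral_set1 subrr.
  have n0 : (0 : R) < n.+2%:R^-1 by rewrite invr_gt0.
  have nn : (n.+2%:R^-1 : R) < n.+2%:R by rewrite (@lt_trans _ _ 1) ?invf_lt1 ?ltr1n.
  (* Integration by parts in disguise: the combined integrand [f] is the derivative of
     [u^s exp (- u)]. *)
  pose F u : R := u `^ s * expR (- u).
  have dF u : 0 < u -> is_derive u 1 F (f u).
    move=> u0; have h1 := is_derive1_powR s u0.
    have h2 : is_derive u 1 (fun u : R => expR (- u)) (- expR (- u)).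
      have := is_derive1_comp (f := expR) (g := -%R) (is_derive_expR (- u)) (is_deriveNid u 1).
      by rewrite mulrN1.
    apply: (is_derive_eq (is_deriveM h1 h2)); rewrite /GRing.scale/= /f /gamma_int addrK.
    by ring.
  have cf u : 0 < u -> {for u, continuous f}.
    move=> u0; apply: continuousB; last exact: continuous_gamma_int.
    apply: continuousM; first exact: cst_continuous.
    exact: continuous_gamma_int.
  by rewrite /Rintegral (integral_derive_itv n0 nn dF cf).
have lhs : s * (\int[mu]_(u in I_ n) gamma_int s u) -
    (\int[mu]_(u in I_ n) gamma_int (s + 1) u) @[n --> \oo] -->
    s * Gamma s - Gamma (s + 1).
  by apply: cvgB; [apply: cvgMr; exact: Gamma_Rcvg|exact: Gamma_Rcvg].
have := powR_expRN_harmonic_cvg0 s0.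
under [X in X @ _ --> _]eq_fun do rewrite -H.
exact: cvg_unique lhs.
Qed.

(** The integrand is the density of the exponential law of rate 1. *)
Lemma Gamma1 : Gamma 1 = 1 :> R.
Proof.
apply: EFin_inj; rewrite (Gamma_cvg ltr01).2.
have := @integral_exponential_pdf R 1 ltr01 => <-.
rewrite integral_itv_obnd_cbnd; last first.
  by apply/measurable_EFinP; apply: measurable_funTS; exact: measurable_gamma_int.
rewrite integral_mkcond; apply: eq_integral => u _.
rewrite /exponential_pdf/= restrict_EFin; congr EFin.
rewrite !patchE; case: ifP => // /set_mem; rewrite /= in_itv/= andbT => u0.
by rewrite /gamma_int subrr powRr0 mulN1r.
Qed.

End gamma_function.

(** * Pochhammer symbols and the binomial series *)

Section pochhammer.
Context {R : comNzRingType}.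
Implicit Types A : R.

Definition poch A n : R := \prod_(i < n) (A + i%:R).

Lemma poch0 A : poch A 0 = 1.
Proof. by rewrite /poch big_ord0. Qed.

Lemma pochS A n : poch A n.+1 = poch A n * (A + n%:R).
Proof. by rewrite /poch big_ord_recr. Qed.

Lemma pochD A m n : poch A (m + n) = poch A m * poch (A + m%:R) n.
Proof.
elim: n => [|n IH]; first by rewrite addn0 poch0 mulr1.
by rewrite addnS !pochS IH natrD addrA mulrA.
Qed.

(* The Pfaff-Saalschuetz summation, cleared of denominators. *)
Lemma saalschuetz j m i A :
  \sum_(n < i.+1) 'C(j, n)%:R * 'C(m, i - n)%:R * poch (A + n%:R) (j + m) =
  'C(j + m, i)%:R * poch (A + i%:R) j * poch (A + j%:R) m.
Proof.
elim: j m i A => [|j IHj].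
  move=> m i A; rewrite add0n big_ord_recl/= subn0 bin0 big1 => [|n _].
    by rewrite !addr0 poch0 mul1r mulr1.
  by rewrite /= /bump/= add1n bin0n !mul0r.
elim=> [|m IHm] i A.
  rewrite big_ord_recr/= subnn bin0 mulr1 addn0 poch0 mulr1 big1 ?add0r// => n _.
  by rewrite bin0n subn_eq0 leqNgt ltn_ord mulr0 mul0r.
case: i => [|i].
  by rewrite big_ord1/= !bin0 !mul1r addr0 pochD.
(* The last factor [A + n + k] of the Pochhammer symbol is split into [A + k] and [n]. Pascal's rule
   for [C(m + 1, i + 1 - n)] lowers [m] in the first part; [n C(j + 1, n) = (j + 1) C(j, n - 1)]
   lowers [j] in the second and shifts [A] by 1, hence the induction for all [A]. *)
pose k := (j.+1 + m)%N.
have -> : \sum_(n < i.+2) 'C(j.+1, n)%:R * 'C(m.+1, i.+1 - n)%:R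
      * poch (A + n%:R) (j.+1 + m.+1) =
    (A + k%:R) * (\sum_(n < i.+2) 'C(j.+1, n)%:R * 'C(m, i.+1 - n)%:R * poch (A + n%:R) k
       + \sum_(n < i.+1) 'C(j.+1, n)%:R * 'C(m, i - n)%:R * poch (A + n%:R) k)
    + j.+1%:R * \sum_(n < i.+1) 'C(j, n)%:R * 'C(m.+1, i - n)%:R
       * poch (A + 1 + n%:R) (j + m.+1).
  have -> : \sum_(n < i.+2) 'C(j.+1, n)%:R * 'C(m.+1, i.+1 - n)%:R
      * poch (A + n%:R) (j.+1 + m.+1) =
    (A + k%:R) * (\sum_(n < i.+2) 'C(j.+1, n)%:R * 'C(m.+1, i.+1 - n)%:R * poch (A + n%:R) k)
    + \sum_(n < i.+2) n%:R * ('C(j.+1, n)%:R * 'C(m.+1, i.+1 - n)%:R * poch (A + n%:R) k).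
    rewrite mulr_sumr -big_split/=; apply: eq_bigr => n _.
    by rewrite addnS -/k pochS; ring.
  congr (_ * _ + _).
    rewrite !(big_ord_recr i.+1)/= subnn !bin0 addrAC; congr (_ + _).
    rewrite -big_split/=; apply: eq_bigr => n _.
    by rewrite subSn ?leq_ord// binS natrD; ring.
  rewrite big_ord_recl/= mul0r add0r mulr_sumr; apply: eq_bigr => n _.
  rewrite /bump/= add1n subSS -!mulrA mulrA -natrM -mul_bin_diag /=.
  have -> : A + n.+1%:R = A + 1 + n%:R by rewrite -addrA nat1r.
  by rewrite natrM /k addnS addSn !mulrA.
rewrite IHm IHm IHj -/k.
have -> : (j + m.+1 = k)%N by rewrite addnS.
have -> : (j.+1 + m.+1 = k.+1)%N by rewrite addnS.
have -> : A + 1 + i%:R = A + i.+1%:R by rewrite -addrA nat1r.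
have -> : A + 1 + j%:R = A + j.+1%:R by rewrite -addrA nat1r.
rewrite binS natrD.
have -> : poch (A + i%:R) j.+1 = (A + i%:R) * poch (A + i.+1%:R) j.
  by rewrite -add1n pochD /poch big_ord1 addr0 -addrA -natrD addn1.
rewrite [poch (A + i.+1%:R) j.+1]pochS [poch (A + j.+1%:R) m.+1]pochS /k.
by rewrite -!natr1 !natrD; ring.
Qed.

End pochhammer.

Section pochhammer_real.
Context {R : realType}.
Implicit Types A : R.

Lemma poch_gt0 A n : 0 < A -> 0 < poch A n.
Proof. by move=> A0; apply: prodr_gt0 => i _; rewrite ltr_wpDr. Qed.

Lemma Gamma_poch A n : 0 < A -> Gamma (A + n%:R) = Gamma A * poch A n.
Proof.
move=> A0; elim: n => [|n IH]; first by rewrite addr0 poch0 mulr1.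
by rewrite -natr1 addrA GammaS ?ltr_wpDr// IH pochS mulrC mulrA.
Qed.

Lemma Gamma_fact n : Gamma (n%:R + 1) = n`!%:R :> R.
Proof.
elim: n => [|n IH]; first by rewrite add0r Gamma1.
by rewrite -natr1 GammaS ?ltr_wpDl// IH factS natrM natr1.
Qed.

End pochhammer_real.

(** * The binomial series *)

Section binomial_series.
Context {R : realType}.
Implicit Types (A x r : R).

Definition pochf A l : R := poch A l / l`!%:R.

(** Keeps denominators [n!] away from 0 in the field identities on series coefficients. *)
Lemma fact_neq0 n : n`!%:R != 0 :> R.
Proof. by rewrite pnatr_eq0 -lt0n fact_gt0. Qed.

Lemma pochf_ge0 A l : 0 <= A -> 0 <= pochf A l.
Proof. by move=> A0; rewrite divr_ge0// prodr_ge0// => i _; rewrite addr_ge0. Qed.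

Lemma pochf_diffs A : pseries_diffs (pochf A) = fun l => A * pochf (A + 1) l.
Proof.
apply/funext => l; rewrite /pseries_diffs /pochf -(add1n l) pochD add1n factS natrM.
rewrite {1}/poch big_ord1 addr0.
by field; rewrite fact_neq0 ?natr1 ?nat1r pnatr_eq0.
Qed.

(** Coefficient form of [(1 - x) (1 - x)^(-A - 1) = (1 - x)^(-A)]. *)
Lemma pochfS A l : pochf (A + 1) l.+1 = pochf A l.+1 + pochf (A + 1) l.
Proof.
rewrite /pochf [poch (A + 1) _]pochS -[in X in _ = X / _ + _](add1n l) pochD factS natrM.
rewrite {2}/poch big_ord1 addr0 -natr1.
by field; rewrite fact_neq0 ?natr1 ?nat1r pnatr_eq0.
Qed.

Lemma le_pochf A B l : 0 <= A -> A <= B -> pochf A l <= pochf B l.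
Proof.
move=> A0 AB; rewrite ler_pM2r ?invr_gt0 ?ltr0n ?fact_gt0//.
by apply: ler_prod => i _; rewrite addr_ge0//= lerD2r.
Qed.

Lemma pochf_series_step A x N :
  (1 - x) * \sum_(l < N) pochf (A + 1) l * x ^+ l =
  \sum_(l < N) pochf A l * x ^+ l -
  (if N is N'.+1 then pochf (A + 1) N' * x ^+ N else 0).
Proof.
elim: N => [|N IH]; first by rewrite !big_ord0 mulr0 subr0.
rewrite !big_ord_recr/= mulrDr IH; case: N {IH} => [|N].
  by rewrite /pochf !poch0 !big_ord0/= expr0 expr1; ring.
by rewrite pochfS !exprS; ring.
Qed.

(** For integer exponents, induction with [pochf_series_step] bounds the partial sums directly; a
    real exponent is then dominated termwise by an integer above it. *)
Lemma pochf_series_nat (M N : nat) x : 0 <= x < 1 ->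
  \sum_(l < N) pochf M%:R l * x ^+ l <= (1 - x) ^- M.
Proof.
move=> /andP[x0 x1]; have x10 : 0 < 1 - x by rewrite subr_gt0.
elim: M => [|M IH].
  rewrite expr0 invr1; case: N => [|N]; first by rewrite big_ord0.
  rewrite big_ord_recl/= /pochf poch0 expr0 fact0 divr1 mulr1 big1 ?addr0// => l _.
  by rewrite /poch big_ord_recl addr0 !mul0r.
rewrite exprS invfM mulrC ler_pdivlMr// mulrC; apply: le_trans IH.
rewrite -natr1 pochf_series_step lerBlDr lerDl; case: N => // N.
by rewrite mulr_ge0 ?exprn_ge0// pochf_ge0// addr_ge0.
Qed.

Lemma pochf_series_le A x : 0 <= A -> 0 <= x < 1 -> exists M, forall N,
  \sum_(l < N) pochf A l * x ^+ l <= M.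
Proof.
move=> A0 x01; exists ((1 - x) ^- (Num.truncn A).+1) => N.
apply: le_trans (pochf_series_nat _ N x01); apply: ler_sum => l _.
rewrite ler_wpM2r ?exprn_ge0//; first by case/andP: x01.
by apply: le_pochf => //; exact/ltW/truncnS_gt.
Qed.

Lemma pochf_has_sum A x : 0 <= A -> 0 <= x < 1 ->
  has_sum (fun l => pochf A l * x ^+ l) (limn (pseries (pochf A) x)).
Proof.
move=> A0 x01; have [M HM] := pochf_series_le A0 x01.
have f0 l : 0 <= pochf A l * x ^+ l.
  by rewrite mulr_ge0 ?pochf_ge0// exprn_ge0//; case/andP: x01.
have [s fs] := nneg_has_sum f0 (sum_fset_le_nat f0 HM).
by rewrite /pseries (cvg_lim (@Rhausdorff _) (has_sum_series fs)).
Qed.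

Lemma pochf_cvg A x : 0 <= A -> 0 <= x < 1 -> cvgn (pseries (pochf A) x).
Proof.
move=> A0 x01; apply/cvg_ex; exists (limn (pseries (pochf A) x)).
exact: has_sum_series (pochf_has_sum A0 x01).
Qed.

Lemma pochf_sumS A x : 0 <= A -> 0 <= x < 1 ->
  (1 - x) * limn (pseries (pochf (A + 1)) x) = limn (pseries (pochf A) x).
Proof.
move=> A0 x01; have A10 : 0 <= A + 1 by rewrite addr_ge0.
have C1 := pochf_cvg A10 x01; have C0 := pochf_cvg A0 x01.
have H : (1 - x) * pseries (pochf (A + 1)) x n @[n --> \oo] -->
    limn (pseries (pochf A) x) - 0.
  (* After the shift at least one term is present, so the leftover of [pochf_series_step] is [x]
     times a term of a convergent series and tends to 0. *)
  rewrite -(cvg_shiftn 1).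
  have -> : (fun n => (1 - x) * pseries (pochf (A + 1)) x (n + 1)%N) =
     (fun n => pseries (pochf A) x (n + 1)%N - x * (pochf (A + 1) n * x ^+ n)).
    apply/funext => n; rewrite /pseries/= /series/= !big_mkord addn1.
    by rewrite pochf_series_step exprS; congr (_ - _); ring.
  apply: cvgB; first by rewrite (cvg_shiftn 1 (pseries (pochf A) x)).
  rewrite -(mulr0 x); apply: cvgMr.
  exact: cvg_series_cvg_0 C1.
rewrite subr0 in H; apply: cvg_unique H; first exact: Rhausdorff.
exact: cvgMr.
Qed.

Lemma is_derive_pochf A x : 0 <= A -> 0 <= x < 1 ->
  is_derive x 1 (fun x => limn (pseries (pochf A) x))
    (A * limn (pseries (pochf (A + 1)) x)).
Proof.
(* Termwise differentiation at [x] asks for convergence of the series and of its first two formal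
   derivatives at a point beyond [x]; the midpoint of [x] and 1 serves. *)
move=> A0 /andP[x0 x1]; pose K := (x + 1) / 2.
have K01 : 0 <= K < 1 by rewrite /K; apply/andP; split; lra.
have scal c B y : 0 <= B -> 0 <= y < 1 ->
    pseries (fun l => c * pochf B l) y @ \oo --> c * limn (pseries (pochf B) y).
  move=> B0 y01; have -> : pseries (fun l => c * pochf B l) y =
      fun n => c * pseries (pochf B) y n.
    apply/funext => n; rewrite /pseries/= /series/= mulr_sumr.
    by apply: eq_bigr => l _; rewrite mulrA.
  by apply: cvgMr; exact: pochf_cvg.
have A10 : 0 <= A + 1 by rewrite addr_ge0.
have A20 : 0 <= A + 1 + 1 by rewrite addr_ge0.
have x01 : 0 <= x < 1 by rewrite x0.
have E1 := pochf_diffs A.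
have E2 : pseries_diffs (pseries_diffs (pochf A)) =
    fun l => A * (A + 1) * pochf (A + 1 + 1) l.
  rewrite E1; apply/funext => l; rewrite /pseries_diffs.
  by have /(congr1 (@^~ l)) := pochf_diffs (A + 1); rewrite /pseries_diffs/= => h; rewrite mulrCA h mulrA.
have H := @pseries_snd_diffs R (pochf A) K x.
rewrite -(cvg_lim (@Rhausdorff _) (scal A (A + 1) x A10 x01)) -E1.
apply: H.
- exact: pochf_cvg.
- by rewrite E1; apply/cvg_ex; eexists; exact: scal A10 K01.
- by rewrite E2; apply/cvg_ex; eexists; exact: scal A20 K01.
- by rewrite !ger0_norm// /K; lra.
Qed.

Lemma pochf_sum A r : 0 <= A -> 0 <= r < 1 ->
  has_sum (fun l => pochf A l * r ^+ l) ((1 - r) `^ (- A)).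
Proof.
move=> A0 r01; suff <- : limn (pseries (pochf A) r) = (1 - r) `^ (- A).
  exact: pochf_has_sum.
have [/andP[r0 r1]] := r01.
pose f x := limn (pseries (pochf A) x).
have f0 : f 0 = 1.
  apply/cvg_lim; first exact: Rhausdorff.
  rewrite -(cvg_shiftn 1); apply: cvg_near_cst; apply: nearW => n.
  rewrite /pseries/= /series/= addn1 big_mkord big_ord_recl/= expr0 mulr1 /pochf poch0 divr1.
  by rewrite big1 ?addr0// => l _; rewrite exprS mul0r mulr0.
(* [g] has derivative 0 on [0, 1): by [pochf_sumS], [f' = A f_(A+1)] means [(1 - x) f' = A f]. Hence
   [g r = g 0 = 1]. *)
pose g x := f x * (1 - x) `^ A.
have dg x : 0 <= x < 1 -> is_derive x 1 g 0.
  move=> /andP[x0 x1]; have x10 : 0 < 1 - x by rewrite subr_gt0.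
  have x01 : 0 <= x < 1 by rewrite x0.
  have h1 := is_derive_pochf A0 x01.
  have h2 : is_derive x 1 (fun y : R => 1 - y) (-1).
    have := is_deriveD (is_derive_cst (1 : R) x (1 : R)) (is_deriveNid x (1 : R)).
    by rewrite add0r.
  have h3 := is_derive1_comp (f := (@powR R)^~ A) (g := fun y : R => 1 - y)
    (is_derive1_powR A x10) h2.
  apply: (is_derive_eq (is_deriveM h1 h3)); rewrite /GRing.scale/=.
  rewrite -(pochf_sumS A0 x01).
  have -> : (1 - x) `^ A = (1 - x) * (1 - x) `^ (A - 1).
    rewrite -[X in X * _](powRr1 (ltW x10)) -powRD ?(gt_eqF x10) ?implybT//.
    by rewrite (addrC 1 (A - 1)) subrK.
  by ring.
have : g r = g 0.
  move: r0; rewrite le_eqVlt => /predU1P[<-//|r0].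
  have [||c _] := @MVT R g (fun=> 0) 0 r r0.
  - move=> x; rewrite in_itv/= => /andP[x0 xr]; apply: dg.
    by rewrite ltW//= (lt_trans xr).
  - apply: derivable_within_continuous => x; rewrite in_itv/= => /andP[x0 xr].
    by have [] := dg x; rewrite ?x0 ?(le_lt_trans xr).
  - by rewrite mul0r => /eqP; rewrite subr_eq0 => /eqP.
rewrite /g f0 subr0 powR1 mulr1 => h; rewrite powRN -[RHS]mul1r.
have p0 : (1 - r) `^ A != 0 by rewrite gt_eqF// powR_gt0// subr_gt0.
exact: (canRL (mulfK p0) h).
Qed.

End binomial_series.

(** * The Hille-Hardy formula *)

Section hille_hardy.
Context {R : realType}.
Implicit Types (A x r z : R).

Definition hyp_term A z n : R := z ^+ n / (n`!%:R * poch A n).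

(* The confluent hypergeometric limit function 0F1(; A; z). *)
Definition hyp A z : R := limn (series (hyp_term A z)).

Lemma expR_abs_has_sum x : abs_has_sum (fun n => x ^+ n / n`!%:R) (expR x).
Proof.
have H (y : R) : 0 <= y -> has_sum (fun n => y ^+ n / n`!%:R) (expR y).
  move=> y0; apply: nneg_series_has_sum => [n|].
    by rewrite divr_ge0// exprn_ge0.
  exact: is_cvg_series_exp_coeff.
have M : abs_sum_le (fun n => x ^+ n / n`!%:R) (expR `|x|).
  move=> B; have P n : 0 <= `|x| ^+ n / n`!%:R by rewrite divr_ge0// exprn_ge0.
  apply: le_trans (has_sum_ge0_le B P (H _ (normr_ge0 x))).
  by apply: ler_sum => n _; rewrite normf_div normrX (ger0_norm (ler0n _ _)).
split; last by exists (expR `|x|).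
apply: abs_series_has_sum M _; exact: is_cvg_series_exp_coeff.
Qed.

Lemma hyp_term_ge0 A z n : 0 < A -> 0 <= z -> 0 <= hyp_term A z n.
Proof. by move=> A0 z0; rewrite divr_ge0 ?exprn_ge0// mulr_ge0// ltW// poch_gt0. Qed.

Lemma norm_hyp_term A z n : 0 < A -> `|hyp_term A z n| = hyp_term A `|z| n.
Proof.
move=> A0; have d : 0 < n`!%:R * poch A n by rewrite mulr_gt0 ?poch_gt0// ltr0n fact_gt0.
by rewrite normf_div normrX (gtr0_norm d).
Qed.

Lemma poch_ge A n : 0 < A -> A <= poch A n.+1.
Proof.
move=> A0; elim: n => [|n IH]; first by rewrite pochS poch0 mul1r addr0.
rewrite pochS (le_trans IH)//; apply: ler_peMr; first exact/ltW/poch_gt0.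
by rewrite -natr1 addrA lerDr addr_ge0// ltW.
Qed.

Lemma hyp_abs_has_sum A z : 0 < A -> abs_has_sum (hyp_term A z) (hyp A z).
Proof.
(* [1 / (A)_n] is 1 for [n = 0] and at most [1 / A] afterwards, so the exponential series
   dominates. *)
move=> A0; have M : abs_sum_le (hyp_term A z) ((1 + A^-1) * expR `|z|).
  move=> B; have := has_sumZ (1 + A^-1) (expR_abs_has_sum `|z|).1.
  move=> /(has_sum_ge0_le B) => H; apply: le_trans (H _).
    apply: ler_sum => n _; rewrite norm_hyp_term// /hyp_term.
    have -> : `|z| ^+ n / (n`!%:R * poch A n) = (poch A n)^-1 * (`|z| ^+ n / n`!%:R).
      by rewrite invfM mulrA mulrC.
    rewrite ler_wpM2r ?divr_ge0 ?exprn_ge0//.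
    case: n => [|n]; first by rewrite poch0 invr1 lerDl invr_ge0 ltW.
    by rewrite ler_wpDl// lef_pV2 ?posrE ?poch_gt0// poch_ge.
  by move=> n; rewrite mulr_ge0 ?addr_ge0 ?invr_ge0 ?(ltW A0)// divr_ge0// exprn_ge0.
have [s hs] := abs_sum_le_has_sum M.
split; last by eexists; exact: M.
by rewrite /hyp (cvg_lim (@Rhausdorff _) (has_sum_series hs)).
Qed.

Lemma sum_pochf_shift A r m : 0 < A -> 0 <= r < 1 ->
  has_sum (fun l => pochf (A + m%:R) l * r ^+ l) ((1 - r) `^ (- A) * (1 - r)^-1 ^+ m).
Proof.
move=> A0 r01; have Am : 0 <= A + m%:R by rewrite addr_ge0// ltW.
have r10 : 0 < 1 - r by rewrite subr_gt0; case/andP: r01.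
rewrite exprVn -(powR_invn _ (ltW r10)) -powRD ?(gt_eqF r10) ?implybT// -opprD.
exact: pochf_sum.
Qed.

(** For [t = (n, p, q, l)]: expanding [H_A (a w^2) exp (b w) exp (c w)] gives the indices [n], [p],
    [q] and the power [w^(2n + p + q)]. Together with [(1 - r)^(-A)] this is
    [(1 - r)^(-(A + 2n + p + q))], whose binomial series gives the index [l]. *)
Definition hh_term A (a b c r : R) (t : nat * nat * nat * nat) : R :=
  hyp_term A a t.1.1.1 * (b ^+ t.1.1.2 / t.1.1.2`!%:R) * (c ^+ t.1.2 / t.1.2`!%:R) *
  (pochf (A + (2 * t.1.1.1 + t.1.1.2 + t.1.2)%:R) t.2 * r ^+ t.2).

Lemma hh_term_abs_has_sum A a b c r : 0 < A -> 0 <= r < 1 ->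
  let w := (1 - r)^-1 in
  abs_has_sum (hh_term A a b c r)
    ((1 - r) `^ (- A) * (hyp A (a * w ^+ 2) * expR (b * w) * expR (c * w))).
Proof.
move=> A0 r01 w.
have r0 : 0 <= r by case/andP: r01.
have r10 : 0 < 1 - r by rewrite subr_gt0; case/andP: r01.
have w0 : 0 <= w by rewrite invr_ge0 ltW.
pose g a b c (t : nat * nat * nat) : R :=
  (1 - r) `^ (- A) * (hyp_term A (a * w ^+ 2) t.1.1 *
    ((b * w) ^+ t.1.2 / t.1.2`!%:R) * ((c * w) ^+ t.2 / t.2`!%:R)).
have gP a' b' c' : abs_has_sum (g a' b' c')
    ((1 - r) `^ (- A) * (hyp A (a' * w ^+ 2) * expR (b' * w) * expR (c' * w))).
  apply: abs_has_sumZ.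
  apply: (abs_has_sum_prod (f := fun t : nat * nat => hyp_term A (a' * w ^+ 2) t.1 *
    ((b' * w) ^+ t.2 / t.2`!%:R)) (g := fun q => (c' * w) ^+ q / q`!%:R)).
    apply: (abs_has_sum_prod (f := fun t => hyp_term A (a' * w ^+ 2) t)
      (g := fun q => (b' * w) ^+ q / q`!%:R)).
      exact: hyp_abs_has_sum.
    exact: expR_abs_has_sum.
  exact: expR_abs_has_sum.
have row a' b' c' t : has_sum (fun l => hh_term A a' b' c' r (t, l)) (g a' b' c' t).
  have -> : g a' b' c' t = hyp_term A a' t.1.1 * (b' ^+ t.1.2 / t.1.2`!%:R) *
      (c' ^+ t.2 / t.2`!%:R) *
      ((1 - r) `^ (- A) * w ^+ (2 * t.1.1 + t.1.2 + t.2)).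
    have -> : w ^+ (2 * t.1.1 + t.1.2 + t.2) = (w ^+ 2) ^+ t.1.1 * w ^+ t.1.2 * w ^+ t.2.
      by rewrite -exprM -!exprD.
    by rewrite /g /hyp_term !exprMn; ring.
  exact: (has_sumZ (hyp_term A a' t.1.1 * (b' ^+ t.1.2 / t.1.2`!%:R) *
    (c' ^+ t.2 / t.2`!%:R)) (sum_pochf_shift (2 * t.1.1 + t.1.2 + t.2) A0 r01)).
(* For [A > 0] and [r >= 0] the absolute value of a term is the term at [|a|], [|b|], [|c|], so the
   absolute row sums have a closed form too. *)
apply: (abs_has_sum_rows (row a b c) (G := g `|a| `|b| `|c|)) => [t||].
- apply: eq_has_sum (row _ _ _ t) => l; rewrite /hh_term 3!normrM norm_hyp_term//=.
  rewrite !normf_div normrM !normrX !(ger0_norm (ler0n _ _)) (ger0_norm r0).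
  by rewrite (ger0_norm (pochf_ge0 _ _))// addr_ge0// ltW.
- exact: gP.
- have [gs _] := gP `|a| `|b| `|c|.
  eexists; apply: has_sum_abs_sum_le gs => t.
  rewrite mulr_ge0 ?powR_ge0//; apply: mulr_ge0; last by rewrite divr_ge0// exprn_ge0// mulr_ge0.
  apply: mulr_ge0; last by rewrite divr_ge0// exprn_ge0// mulr_ge0.
  by apply: hyp_term_ge0 => //; apply: mulr_ge0; rewrite // exprn_ge0.
Qed.

(* The new indices are k = n + p + q + l, i = n + p and j = n + q. *)
Lemma hh_term_regroup A a b c r s : abs_has_sum (hh_term A a b c r) s ->
  abs_has_sum (fun k => \sum_(i < k.+1) \sum_(j < k.+1) \sum_(n < i.+1)
    (if (n <= j)%N && (i + j <= k + n)%N
     then hh_term A a b c r (n : nat, (i - n)%N, (j - n)%N, (k + n - (i + j))%N) else 0)) s.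
Proof.
move=> Fs.
pose G (t : nat * nat * nat * nat) : R := let: (k, i, j, n) := t in
  if (n <= i)%N && ((n <= j)%N && (i + j <= k + n)%N)
  then hh_term A a b c r (n, (i - n)%N, (j - n)%N, (k + n - (i + j))%N) else 0.
pose h (t : nat * nat * nat * nat) : nat * nat * nat * nat := let: (n, p, q, l) := t in
  (n + p + q + l, n + p, n + q, n)%N.
have Gs : abs_has_sum G s.
  apply: (abs_has_sum_reindex (h := h)).
  - move=> [[[n p] q] l] [[[n' p'] q'] l'] [e1 e2 e3 e4]; subst n'.
    by congr (_, _, _, _); lia.
  - move=> [[[k i] j] n]; rewrite /G; case: ifPn => [|_]; last by rewrite eqxx.
    move=> /and3P[h1 h2 h3] _; exists (n, i - n, j - n, k + n - (i + j))%N.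
    by congr (_, _, _, _); lia.
  - apply: eq_abs_has_sum Fs => -[[[n p] q] l] /=.
    rewrite !leq_addr/= ifT; last by lia.
    by congr (hh_term _ _ _ _ _ (_, _, _, _)); lia.
(* The indices [n], [j], [i] are summed out in this order. All rows are finite, since [n <= i],
   [j <= k] and [i <= k] on the support of [G]. *)
have G1 : abs_has_sum (fun t : nat * nat * nat => \sum_(n < t.1.2.+1) G (t, n : nat)) s.
  apply: abs_has_sum_fubini Gs _ => -[[k i] j].
  apply: (has_sum_nat_finite (N := i.+1)) => n ni.
  by rewrite /G leqNgt ni.
have G2 : abs_has_sum (fun t : nat * nat => \sum_(j < t.1.+1) \sum_(n < t.2.+1) G (t, j : nat, n : nat)) s.
  apply: abs_has_sum_fubini G1 _ => -[k i].
  apply: (has_sum_nat_finite (N := k.+1)) => j jk /=.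
  apply: big1 => n _; rewrite ifF//; apply/negP => /and3P[h1 h2 h3]; lia.
have G3 : abs_has_sum (fun k => \sum_(i < k.+1) \sum_(j < k.+1) \sum_(n < i.+1) G (k, i : nat, j : nat, n : nat)) s.
  apply: abs_has_sum_fubini G2 _ => k.
  apply: (has_sum_nat_finite (N := k.+1)) => i ik /=.
  apply: big1 => j _; apply: big1 => n _; rewrite ifF//; apply/negP => /and3P[h1 h2 h3]; lia.
apply: eq_abs_has_sum G3 => k; apply: eq_bigr => i _; apply: eq_bigr => j _.
by apply: eq_bigr => n _; rewrite /G -ltnS ltn_ord.
Qed.

Lemma bin_natf (n m : nat) : (m <= n)%N ->
  'C(n, m)%:R = n`!%:R / (m`!%:R * (n - m)`!%:R) :> R.
Proof.
move=> mn; rewrite -(bin_fact mn) natrM natrM mulfK//.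
Qed.

(** With [k], [i], [j] the regrouped indices, the prefactor depends on [n, p, q, l] only through
    them: [(n + q)! = j!], [(p + l)! = (k - j)!], and the signs are absorbed by
    [X^n Y^n = (-X)^n (-Y)^n]. What remains is the summand of [saalschuetz], thanks to [(A)_(2n+p+q)
    (A+2n+p+q)_l = (A)_n (A+n)_k]. *)
Lemma hh_term_coef A (X Y r : R) n p q l : 0 < A ->
  hh_term A (X * Y * r) (- (X * r)) (- (Y * r)) r (n, p, q, l) =
  (- X) ^+ (n + p) * (- Y) ^+ (n + q) * r ^+ (n + p + q + l) /
    (poch A (2 * n + p + q) * (n + q)`!%:R * (p + l)`!%:R) *
  ('C(n + q, n)%:R * 'C(p + l, p)%:R * poch (A + n%:R) (n + p + q + l)).
Proof.
move=> A0.
have p0 (B : R) m : 0 < B -> poch B m != 0 by move=> B0; rewrite gt_eqF// poch_gt0.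
have pE : poch A (2 * n + p + q) * poch (A + (2 * n + p + q)%:R) l =
    poch A n * poch (A + n%:R) (n + p + q + l).
  by rewrite -!pochD; congr poch; lia.
have -> : poch (A + n%:R) (n + p + q + l) =
    poch A (2 * n + p + q) * poch (A + (2 * n + p + q)%:R) l / poch A n.
  by rewrite pE mulrC mulKf// p0.
rewrite !bin_natf ?leq_addr// !addKn /hh_term/= /hyp_term /pochf -!mulNr !exprMn !exprD.
have -> : X ^+ n * Y ^+ n = (- X) ^+ n * (- Y) ^+ n by rewrite -!exprMn mulrNN.
by field; rewrite !fact_neq0 !p0.
Qed.

Lemma hh_term_inner_sum A (X Y r : R) k i j : 0 < A -> (i <= k)%N -> (j <= k)%N ->
  \sum_(n < i.+1) (if (n <= j)%N && (i + j <= k + n)%N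
     then hh_term A (X * Y * r) (- (X * r)) (- (Y * r)) r
       (n : nat, (i - n)%N, (j - n)%N, (k + n - (i + j))%N) else 0) =
  r ^+ k * (k`!%:R * poch A k) *
    ((- X) ^+ i / (i`!%:R * (k - i)`!%:R * poch A i)) *
    ((- Y) ^+ j / (j`!%:R * (k - j)`!%:R * poch A j)).
Proof.
move=> A0 ik jk.
have p0 (B : R) n : 0 < B -> poch B n != 0 by move=> B0; rewrite gt_eqF// poch_gt0.
transitivity ((- X) ^+ i * (- Y) ^+ j * r ^+ k / (poch A (i + j) * j`!%:R * (k - j)`!%:R) *
    \sum_(n < i.+1) 'C(j, n)%:R * 'C(k - j, i - n)%:R * poch (A + n%:R) (j + (k - j))).
  rewrite mulr_sumr; apply: eq_bigr => n _; have ni : (n <= i)%N by rewrite -ltnS.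
  (* The indices excluded by the condition are those at which one of the two binomial coefficients
     vanishes. *)
  rewrite subnKC//; case: ifPn => [/andP[nj ijkn]|]; last first.
    rewrite negb_and -!ltnNge => /orP[h|h]; first by rewrite (bin_small h) !mul0r mulr0.
    have -> : 'C(k - j, i - n) = 0%N by apply: bin_small; lia.
    by rewrite mulr0 mul0r mulr0.
  rewrite hh_term_coef//.
  have -> : (n + (i - n) = i)%N by lia.
  have -> : (n + (j - n) = j)%N by lia.
  have -> : (i + (j - n) + (k + n - (i + j)) = k)%N by lia.
  have -> : (i - n + (k + n - (i + j)) = k - j)%N by lia.
  by have -> : (2 * n + (i - n) + (j - n) = i + j)%N by lia.
rewrite saalschuetz subnKC// bin_natf//.
have -> : poch (A + i%:R) j = poch A (i + j) / poch A i.
  by rewrite pochD mulrC mulKf// p0.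
have -> : poch (A + j%:R) (k - j) = poch A k / poch A j.
  have -> : poch A k = poch A j * poch (A + j%:R) (k - j) by rewrite -pochD subnKC.
  by rewrite mulrC mulKf// p0.
by field; rewrite !fact_neq0 !p0.
Qed.

Lemma laguerreE A k (x : R) : 0 < A ->
  (laguerre (A - 1) k).[x] =
  poch A k * \sum_(i < k.+1) (- x) ^+ i / (i`!%:R * (k - i)`!%:R * poch A i).
Proof.
move=> A0; have p0 n : poch A n != 0 by rewrite gt_eqF// poch_gt0.
rewrite /laguerre horner_poly mulr_sumr; apply: eq_bigr => i _.
have ik : (i <= k)%N by rewrite -ltnS.
have -> : gbinomial (k%:R + (A - 1)) (k - i) = poch A k / poch A i / (k - i)`!%:R.
  have -> : poch A k = poch A i * poch (A + i%:R) (k - i) by rewrite -pochD subnKC.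
  rewrite /gbinomial (mulrC (poch A i)) mulfK//.
  (* The falling product of [gbinomial] is the rising one read backwards. *)
  congr (_ / _); rewrite /poch (reindex_inj rev_ord_inj)/=; apply: eq_bigr => m _.
  have mk : (m < k - i)%N by [].
  have e : (k = i + m + (k - i - m.+1) + 1)%N by lia.
  rewrite [in X in X + _ - _]e !natrD; ring.
rewrite -[- x]mulN1r exprMn; field.
by rewrite !fact_neq0 p0.
Qed.

(** In the classical form [hyp A z] appears as [Gamma(A) z^((1 - A) / 2) I_(A-1)(2 sqrt z)], with a
    modified Bessel function. *)
Lemma hille_hardy A (X Y r : R) : 0 < A -> 0 <= r < 1 ->
  let w := (1 - r)^-1 in
  abs_has_sum (fun k => r ^+ k * (k`!%:R / poch A k) *
      (laguerre (A - 1) k).[X] * (laguerre (A - 1) k).[Y])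
    ((1 - r) `^ (- A) * (hyp A (X * Y * r * w ^+ 2) * expR (- (X * r) * w) * expR (- (Y * r) * w))).
Proof.
move=> A0 r01 w; have p0 n : poch A n != 0 by rewrite gt_eqF// poch_gt0.
apply: eq_abs_has_sum (hh_term_regroup (hh_term_abs_has_sum _ _ _ A0 r01)) => k.
rewrite !laguerreE//.
set s1 := \sum_(i < k.+1) (- X) ^+ i / _; set s2 := \sum_(i < k.+1) (- Y) ^+ i / _.
transitivity (r ^+ k * (k`!%:R * poch A k) * s1 * s2).
  rewrite /s1 /s2 -[in RHS]mulrA big_distrlr/= mulr_sumr; apply: eq_bigr => i _.
  rewrite mulr_sumr; apply: eq_bigr => j _.
  by rewrite hh_term_inner_sum ?leq_ord// !mulrA.
by field; rewrite p0.
Qed.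

End hille_hardy.

(** * Comparison of the functions H_A *)

Section hyp_comparison.
Context {R : realType}.
Implicit Types (a b z : R).

(** Governs the growth of the logarithm of [(a)_n / (b)_n * (n + 1)^(b - a)] in one step. The two
    terms on the left cancel up to order [n^(-2)], and the error is written as a telescoping
    difference so that it stays bounded after summation. *)
Lemma poch_ratio_step a b n : 0 < a -> 0 < b ->
  (a - b) / (b + n%:R) + (b - a) * ln (n.+2%:R / n.+1%:R) <=
  `|a - b| * (b + 2) * (1 + 2 / b) * (n.+1%:R^-1 - n.+2%:R^-1).
Proof.
move=> a0 b0.
have n0 : 0 <= n%:R :> R by [].
have n10 : 0 < n%:R + 1 :> R by rewrite ltr_wpDl.
have n20 : 0 < n%:R + 2 :> R by rewrite ltr_wpDl.
have bn0 : 0 < b + n%:R by rewrite ltr_wpDr.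
have e1 : n.+1%:R = n%:R + 1 :> R by rewrite natr1.
have e2 : n.+2%:R = n%:R + 2 :> R by rewrite -addn2 natrD.
have hc : (n%:R + 2) / (b + n%:R) <= 1 + 2 / b.
  rewrite ler_pdivrMr//.
  have -> : (1 + 2 / b) * (b + n%:R) = n%:R + 2 + (b + 2 * n%:R / b) by field; rewrite gt_eqF.
  by rewrite lerDl addr_ge0 ?(ltW b0)// divr_ge0 ?mulr_ge0// ltW.
have d0 : 0 < (n%:R + 1) * (n%:R + 2) :> R by rewrite mulr_gt0.
set d := (n%:R + 1) * (n%:R + 2) in d0.
have key c e : `|e| <= b + 2 -> 0 <= c -> c <= n%:R + 2 ->
    e * (c / (b + n%:R) / d) <= (b + 2) * (1 + 2 / b) / d.
  move=> eb c0 cn; apply: le_trans (ler_norm _) _; rewrite normrM -[leRHS]mulrA.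
  rewrite (ger0_norm (_ : 0 <= c / (b + n%:R) / d)) ?divr_ge0 ?(ltW bn0) ?(ltW d0)//.
  apply: ler_pM => //; first by rewrite !divr_ge0 ?(ltW bn0) ?(ltW d0).
  rewrite ler_pM2r ?invr_gt0//; apply: le_trans hc.
  by rewrite ler_pM2r ?invr_gt0.
rewrite e1 e2.
have -> : (n%:R + 1)^-1 - (n%:R + 2)^-1 = d^-1 :> R.
  by rewrite /d; field; rewrite !gt_eqF.
(* The sign of [b - a] decides how [ln (1 + v) <= v] is used: with [v = 1 / (n + 1)] if [a <= b],
   and on the inverse ratio with [v = - 1 / (n + 2)] otherwise. *)
have [ab|ba] := leP a b.
  apply: (@le_trans _ _ ((b - a) * ((n%:R + 1)^-1 - (b + n%:R)^-1))).
    have -> : (b - a) * ((n%:R + 1)^-1 - (b + n%:R)^-1) =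
      (a - b) / (b + n%:R) + (b - a) * (n%:R + 1)^-1 by field; rewrite !gt_eqF.
    rewrite lerD2l ler_wpM2l ?subr_ge0//.
    have -> : (n%:R + 2) / (n%:R + 1) = 1 + (n%:R + 1)^-1 :> R by field; rewrite gt_eqF.
    by apply: le_ln1Dx; rewrite (@lt_le_trans _ _ 0) ?ltrN10// invr_ge0 ltW.
  rewrite ler0_norm ?subr_le0// opprB.
  have -> : (n%:R + 1)^-1 - (b + n%:R)^-1 = (b - 1) * ((n%:R + 2) / (b + n%:R) / d).
    by rewrite /d; field; rewrite !gt_eqF.
  have -> : (b - a) * (b + 2) * (1 + 2 / b) / d = (b - a) * ((b + 2) * (1 + 2 / b) / d).
    by rewrite !mulrA.
  rewrite ler_wpM2l ?subr_ge0// key//.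
    by rewrite ler_norml; apply/andP; split; lra.
apply: (@le_trans _ _ ((a - b) * ((b + n%:R)^-1 - (n%:R + 2)^-1))).
  have -> : (a - b) * ((b + n%:R)^-1 - (n%:R + 2)^-1) =
      (a - b) / (b + n%:R) + (a - b) * - (n%:R + 2)^-1 by field; rewrite !gt_eqF.
  rewrite lerD2l -[b - a]opprB mulNr -mulrN ler_wpM2l ?subr_ge0 ?(ltW ba)//.
  rewrite -lnV ?posrE ?divr_gt0// invf_div.
  have -> : (n%:R + 1) / (n%:R + 2) = 1 + - (n%:R + 2)^-1 :> R by field; rewrite gt_eqF.
  by apply: le_ln1Dx; rewrite ltrN2 invf_lt1//; lra.
rewrite gtr0_norm ?subr_gt0//.
have -> : (b + n%:R)^-1 - (n%:R + 2)^-1 = (2 - b) * ((n%:R + 1) / (b + n%:R) / d).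
  by rewrite /d; field; rewrite !gt_eqF.
have -> : (a - b) * (b + 2) * (1 + 2 / b) / d = (a - b) * ((b + 2) * (1 + 2 / b) / d).
  by rewrite !mulrA.
rewrite ler_wpM2l ?subr_ge0 ?(ltW ba)// key//.
- by rewrite ler_norml; apply/andP; split; lra.
- by rewrite lerD2l ler1n.
Qed.

Lemma poch_ratio a b : 0 < a -> 0 < b -> exists2 C : R, 0 < C &
  forall n, poch a n / poch b n <= C * n.+1%:R `^ (a - b).
Proof.
move=> a0 b0; pose K := `|a - b| * (b + 2) * (1 + 2 / b).
have K0 : 0 <= K.
  by rewrite !mulr_ge0 ?addr_ge0 ?divr_ge0 ?(ltW b0).
exists (expR K); first exact: expR_gt0.
(* The stronger exponent records the telescoped errors up to [n], which makes the induction
   close. *)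
suff H n : poch a n / poch b n * n.+1%:R `^ (b - a) <= expR (K * (1 - n.+1%:R^-1)).
  move=> n; have n0 : (0 : R) < n.+1%:R by [].
  rewrite -opprB powRN ler_pdivlMr ?powR_gt0//; apply: le_trans (H n) _.
  by rewrite ler_expR -[leRHS]mulr1 ler_wpM2l// lerBlDr lerDl invr_ge0.
elim: n => [|n IH].
  by rewrite !poch0 divr1 powR1 mulr1 invr1 subrr mulr0 expR0.
have bn0 : 0 < b + n%:R by rewrite ltr_wpDr.
have an0 : 0 < a + n%:R by rewrite ltr_wpDr.
have pa := poch_gt0 n a0; have pb := poch_gt0 n b0.
have n1 : (0 : R) < n.+1%:R by [].
have n2 : (0 : R) < n.+2%:R by [].
have E : n.+2%:R `^ (b - a) = n.+1%:R `^ (b - a) * expR ((b - a) * ln (n.+2%:R / n.+1%:R)) :> R.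
  have -> : expR ((b - a) * ln (n.+2%:R / n.+1%:R)) = (n.+2%:R / n.+1%:R) `^ (b - a).
    by rewrite [RHS]/powR gt_eqF// divr_gt0.
  by rewrite -powRM ?divr_ge0// (mulrC n.+1%:R) divfK// gt_eqF.
rewrite !pochS E.
set e := expR _; set q := n.+1%:R `^ _.
have -> : poch a n * (a + n%:R) / (poch b n * (b + n%:R)) * (q * e) =
   (poch a n / poch b n * q) * ((a + n%:R) / (b + n%:R) * e).
  by field; rewrite !gt_eqF.
have -> : K * (1 - n.+2%:R^-1) = K * (1 - n.+1%:R^-1) + K * (n.+1%:R^-1 - n.+2%:R^-1).
  by rewrite -mulrDr; congr (_ * _); rewrite addrA subrK.
rewrite expRD; apply: ler_pM => //.
- by rewrite mulr_ge0 ?powR_ge0// divr_ge0// ltW.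
- by rewrite mulr_ge0 ?expR_ge0// divr_ge0// ltW.
apply: (@le_trans _ _ (expR ((a - b) / (b + n%:R)) * e)).
  rewrite ler_wpM2r ?expR_ge0//.
  have -> : (a + n%:R) / (b + n%:R) = 1 + (a - b) / (b + n%:R) by field; rewrite gt_eqF.
  exact: expR_ge1Dx.
by rewrite /e -expRD ler_expR; exact: poch_ratio_step.
Qed.

Lemma hyp_termS a z n : 0 < a ->
  n.+1%:R * (a + n%:R) * hyp_term a z n.+1 = z * hyp_term a z n.
Proof.
move=> a0; have pa := poch_gt0 n a0.
have an0 : 0 < a + n%:R by rewrite ltr_wpDr.
rewrite /hyp_term pochS factS natrM exprS.
by field; rewrite fact_neq0 !gt_eqF// ltr_wpDl.
Qed.

Lemma sum_hyp_term_le a z N : 0 < a -> 0 <= z ->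
  \sum_(n < N) hyp_term a z n <= hyp a z.
Proof.
move=> a0 z0; have [H _] := hyp_abs_has_sum z a0.
rewrite -(big_mkord xpredT) -sum_fset_iota.
by apply: has_sum_ge0_le H => n; exact: hyp_term_ge0.
Qed.

Lemma hyp_ge1 a z : 0 < a -> 0 <= z -> 1 <= hyp a z.
Proof.
move=> a0 z0; apply: le_trans (sum_hyp_term_le 1 a0 z0).
by rewrite big_ord1 /hyp_term expr0 poch0 fact0 mulr1 divr1.
Qed.

Lemma hyp_moment a m : 0 < a -> exists2 C : R, 0 < C & forall z N, 0 <= z ->
  \sum_(n < N) hyp_term a z n * n.+1%:R ^+ (2 * m) <= C * (1 + z) ^+ m * hyp a z.
Proof.
move=> a0; elim: m => [|m [C C0 IH]].
  exists 1 => // z N z0; rewrite muln0 expr0 !mul1r.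
  by under eq_bigr do rewrite expr0 mulr1; exact: sum_hyp_term_le.
(* From [n + 2 <= 2 (n + 1)], used [2m + 2] times, and [n + 1 <= (1 + 1 / a) (a + n)], which creates
   the factor that the recurrence [hyp_termS] consumes. *)
pose c : R := 4 * (1 + a^-1) * 4 ^+ m.
have c0 : 0 < c by rewrite !mulr_gt0 ?exprn_gt0// addr_gt0// invr_gt0.
exists (1 + c * C) => [|z N z0]; first by rewrite addr_gt0// mulr_gt0.
have z10 : 1 <= 1 + z by rewrite lerDl.
have H1 := hyp_ge1 a0 z0.
have H0 : 0 <= hyp a z by apply: le_trans H1.
have Z1 : 1 <= (1 + z) ^+ m.+1 by exact: exprn_ege1.
have step n : hyp_term a z n.+1 * n.+2%:R ^+ (2 * m.+1) <=
    c * z * (hyp_term a z n * n.+1%:R ^+ (2 * m)).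
  have p0 : 0 <= hyp_term a z n.+1 by exact: hyp_term_ge0.
  have e : z * (hyp_term a z n * n.+1%:R ^+ (2 * m)) =
     hyp_term a z n.+1 * (n.+1%:R * (a + n%:R) * n.+1%:R ^+ (2 * m)).
    by rewrite mulrA -hyp_termS//; ring.
  rewrite -mulrA e mulrCA ler_wpM2l//.
  have h2 : n.+2%:R <= 2 * n.+1%:R :> R by rewrite -natrM ler_nat; lia.
  have -> : c * (n.+1%:R * (a + n%:R) * n.+1%:R ^+ (2 * m)) =
     (2 * n.+1%:R) ^+ (2 * m) * ((2 * n.+1%:R) * (2 * ((1 + a^-1) * (a + n%:R)))).
    rewrite exprMn [2 ^+ (2 * m)]exprM /c (_ : 2 ^+ 2 = 4 :> R); last by rewrite -natrX.
    by ring.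
  rewrite mulnS addnC exprD; apply: ler_pM; rewrite ?exprn_ge0//.
    by apply: lerXn2r; rewrite ?nnegrE.
  rewrite expr2; apply: ler_pM => //; apply: (le_trans h2).
  rewrite ler_pM2l//.
  have -> : (1 + a^-1) * (a + n%:R) = n.+1%:R + (a + n%:R / a).
    by rewrite -natr1; field; rewrite gt_eqF.
  by rewrite lerDl addr_ge0 ?divr_ge0 ?(ltW a0).
have z11 : 0 <= 1 + z by rewrite addr_ge0.
have T0 : 0 <= C * (1 + z) ^+ m * hyp a z.
  by apply: mulr_ge0 => //; apply: mulr_ge0; rewrite ?(ltW C0)// exprn_ge0.
have cz0 : 0 <= c * z by apply: mulr_ge0; rewrite ?(ltW c0).
(* The recurrence reaches only positive indices; the summand 1 is the term [n = 0]. *)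
apply: (@le_trans _ _ (1 + c * z * (C * (1 + z) ^+ m * hyp a z))).
  case: N => [|N].
    by rewrite big_ord0 addr_ge0//; apply: mulr_ge0.
  rewrite big_ord_recl; apply: lerD.
    by rewrite /hyp_term expr0 poch0 fact0 mulr1 divr1 expr1n mulr1.
  apply: le_trans (ler_wpM2l _ (IH z N z0)) => //.
  by rewrite mulr_sumr; apply: ler_sum => n _; exact: step.
rewrite !mulrDl mul1r; apply: lerD.
  by rewrite -[leLHS]mulr1 ler_pM.
rewrite exprS.
have -> : c * z * (C * (1 + z) ^+ m * hyp a z) = z * (c * (C * (1 + z) ^+ m * hyp a z)) by ring.
have -> : c * C * ((1 + z) * (1 + z) ^+ m) * hyp a z =
  (1 + z) * (c * (C * (1 + z) ^+ m * hyp a z)) by ring.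
rewrite ler_wpM2r ?lerDr//.
by apply: mulr_ge0; rewrite ?(ltW c0).
Qed.

(** The recurrence is used in the opposite direction. One factor [1 + z] is split: for the part 1
    the weights only decrease, and the part [z] moves a term from [n] to [n + 1], hence the sum up
    to [N.+1]. *)
Lemma hyp_inv_moment a m : 0 < a -> exists2 C : R, 0 < C & forall z N, 0 <= z ->
  (1 + z) ^+ m * (\sum_(n < N) hyp_term a z n * n.+1%:R ^- (2 * m)) <= C * hyp a z.
Proof.
move=> a0; elim: m => [|m [C C0 IH]].
  exists 1 => // z N z0; rewrite muln0 expr0 !mul1r.
  by under eq_bigr do rewrite expr0 invr1 mulr1; exact: sum_hyp_term_le.
(* From [a + n <= (1 + a) (n + 1)] and [(n + 2) / 2 <= n + 1]. *)
pose c : R := (1 + a) * 4 ^+ m.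
have c0 : 0 < c by rewrite mulr_gt0 ?exprn_gt0// addr_gt0.
exists (C + c * C) => [|z N z0]; first by rewrite addr_gt0// mulr_gt0.
have z10 : 0 <= 1 + z by rewrite addr_ge0.
have p0 n : 0 <= hyp_term a z n by exact: hyp_term_ge0.
have h1 n : hyp_term a z n * n.+1%:R ^- (2 * m.+1) <= hyp_term a z n * n.+1%:R ^- (2 * m).
  rewrite ler_wpM2l// lef_pV2 ?posrE ?exprn_gt0//.
  by apply: ler_weXn2l; [rewrite ler1n|lia].
have h2 n : z * (hyp_term a z n * n.+1%:R ^- (2 * m.+1)) <=
    c * (hyp_term a z n.+1 * n.+2%:R ^- (2 * m)).
  have -> : z * (hyp_term a z n * n.+1%:R ^- (2 * m.+1)) =
     hyp_term a z n.+1 * ((a + n%:R) / n.+1%:R * n.+1%:R ^- (2 * m)).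
    rewrite mulrA -hyp_termS// mulnS exprD expr2.
    by field; rewrite ?mulf_neq0 ?expf_neq0 ?pnatr_eq0// nat1r pnatr_eq0.
  rewrite [leRHS]mulrCA ler_wpM2l//.
  have -> : c / n.+2%:R ^+ (2 * m) = (1 + a) * (n.+2%:R / 2) ^- (2 * m).
    rewrite exprMn exprVn [2 ^+ (2 * m)]exprM invfM invrK /c.
    by rewrite (_ : 2 ^+ 2 = 4 :> R) 1?mulrAC ?mulrA// -natrX.
  apply: ler_pM; rewrite ?divr_ge0 ?invr_ge0 ?exprn_ge0 ?addr_ge0 ?(ltW a0)//.
    rewrite ler_pdivrMr// mulrDl mul1r -natr1 mulrDr mulr1.
    have : 0 <= a * n%:R by rewrite mulr_ge0// ltW.
    by move=> ?; lra.
  rewrite lef_pV2 ?posrE ?exprn_gt0 ?divr_gt0//.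
  apply: lerXn2r; rewrite ?nnegrE ?divr_ge0// ler_pdivrMr// -natrM ler_nat; lia.
rewrite exprSr mulrDr mulr1 mulrDl.
have mono : (1 + z) ^+ m * (\sum_(n < N) hyp_term a z n * n.+1%:R ^- (2 * m.+1)) <= C * hyp a z.
  apply: le_trans (IH z N z0); rewrite ler_wpM2l ?exprn_ge0//.
  by apply: ler_sum => n _; exact: h1.
rewrite [leRHS]mulrDl lerD//.
rewrite -mulrA -[leRHS]mulrA; apply: (@le_trans _ _ (c * ((1 + z) ^+ m * \sum_(n < N.+1) hyp_term a z n * n.+1%:R ^- (2 * m)))).
  rewrite [leRHS]mulrCA ler_wpM2l ?exprn_ge0// big_ord_recl mulrDr.
  rewrite mulr_sumr mulr_sumr -[leLHS]add0r lerD//.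
    by rewrite mulr_ge0 ?(ltW c0)// mulr_ge0// invr_ge0 exprn_ge0.
  by apply: ler_sum => n _; exact: h2.
by rewrite ler_wpM2l ?(ltW c0)// IH.
Qed.

Lemma powR_le_moments (u s : R) m : 0 < u -> `|s| <= m%:R -> u `^ s <= u ^+ m + u ^- m.
Proof.
move=> u0; rewrite ler_norml => /andP[sm ms].
have [u1|u1] := leP 1 u.
  by rewrite (le_trans (ler_powR u1 ms))// powR_mulrn ?(ltW u0)// lerDl invr_ge0 exprn_ge0// ltW.
apply: (@le_trans _ _ (u `^ (- m%:R))); first by rewrite ger_powR// u0 ltW.
by rewrite powR_invn ?(ltW u0)// lerDr exprn_ge0// ltW.
Qed.

(** The n-th terms of the two series differ by the factor [(a)_n / (b)_n], at most a constant times
    [(n + 1)^(a - b) = (1 + z)^s u^s] with [u = (n + 1)^2 / (1 + z)]; the moments [m] and [-m] then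
    control [u^s]. *)
Lemma hyp_le a b : 0 < a -> 0 < b -> exists2 C : R, 0 < C & forall z, 0 <= z ->
  hyp b z <= C * ((1 + z) `^ ((a - b) / 2) * hyp a z).
Proof.
move=> a0 b0; pose s := (a - b) / 2; pose m := (Num.truncn `|s|).+1.
have sm : `|s| <= m%:R by exact/ltW/truncnS_gt.
have [C1 C10 H1] := poch_ratio a0 b0.
have [C2 C20 H2] := hyp_moment m a0.
have [C3 C30 H3] := hyp_inv_moment m a0.
exists (C1 * (C2 + C3)) => [|z z0]; first by rewrite mulr_gt0// addr_gt0.
have z10 : 0 < 1 + z by rewrite ltr_pwDl.
apply: has_sum_le_bound (hyp_abs_has_sum z b0).1 _.
apply: sum_fset_le_nat => [n|N]; first exact: hyp_term_ge0.
rewrite -/s.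
have key n : hyp_term b z n <= C1 * (1 + z) `^ s *
   (hyp_term a z n * n.+1%:R ^+ (2 * m) * (1 + z) ^- m +
    (1 + z) ^+ m * (hyp_term a z n * n.+1%:R ^- (2 * m))).
  have pa := poch_gt0 n a0; have pb := poch_gt0 n b0.
  have -> : hyp_term b z n = hyp_term a z n * (poch a n / poch b n).
    by rewrite /hyp_term; field; rewrite fact_neq0 !gt_eqF.
  have p0 : 0 <= hyp_term a z n by exact: hyp_term_ge0.
  apply: le_trans (ler_wpM2l p0 (H1 n)) _.
  pose u : R := n.+1%:R ^+ 2 / (1 + z).
  have u0 : 0 < u by rewrite divr_gt0// exprn_gt0.
  have -> : n.+1%:R `^ (a - b) = (1 + z) `^ s * u `^ s :> R.
    rewrite -powRM ?(ltW z10) ?(ltW u0)// /u mulrC divfK ?gt_eqF//.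
    by rewrite -powR_mulrn// -powRrM /s mulrC divfK.
  have -> : hyp_term a z n * n.+1%:R ^+ (2 * m) * (1 + z) ^- m +
    (1 + z) ^+ m * (hyp_term a z n * n.+1%:R ^- (2 * m)) =
    hyp_term a z n * (u ^+ m + u ^- m).
    rewrite /u exprMn -exprM exprVn invfM invrK; ring.
  rewrite mulrCA -[leRHS]mulrA ler_wpM2l ?(ltW C10)// mulrCA ler_wpM2l ?powR_ge0//.
  by rewrite ler_wpM2l// powR_le_moments.
apply: (@le_trans _ _ (\sum_(n < N) C1 * (1 + z) `^ s *
   (hyp_term a z n * n.+1%:R ^+ (2 * m) * (1 + z) ^- m +
    (1 + z) ^+ m * (hyp_term a z n * n.+1%:R ^- (2 * m))))).
  by apply: ler_sum => n _; exact: key.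
rewrite -mulr_sumr big_split/= -mulr_suml -mulr_sumr.
have -> : C1 * (C2 + C3) * ((1 + z) `^ s * hyp a z) =
  C1 * (1 + z) `^ s * (C2 * hyp a z + C3 * hyp a z) by ring.
rewrite ler_wpM2l ?mulr_ge0 ?powR_ge0 ?(ltW C10)// lerD ?H3//.
rewrite ler_pdivrMr ?exprn_gt0//; apply: le_trans (H2 z N z0) _.
by rewrite mulrAC.
Qed.

End hyp_comparison.

(** * The heat kernel *)

Section heat_kernel_closed_form.
Context {R : realType}.
Implicit Types (A B G t x y lambda : R).

Definition mehler_r t : R := expR (- (4 * t)).
(* [powR] rather than [^-1]: the library has measurability lemmas only for the former. *)
Definition mehler_w t : R := (1 - mehler_r t) `^ (-1).
Definition gauss_factor t x y : R :=
  expR (- (x ^+ 2 / 2)) * expR (- (y ^+ 2 / 2)) *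
  expR (- (x ^+ 2 * mehler_r t) * mehler_w t) * expR (- (y ^+ 2 * mehler_r t) * mehler_w t).

(** Closed form in the shifted order [A = nu + 1]. The Gaussian part is free of [A], and for [t > 0]
    the base of the power is [1 / (2 sinh (2 t))]. *)
Definition heat_kernel1 A t x y : R := gauss_factor t x y * (2 / Gamma A *
  (expR (- (2 * t)) * mehler_w t) `^ A *
  hyp A (x ^+ 2 * y ^+ 2 * mehler_r t * mehler_w t ^+ 2)).

Lemma mehler_r_lt1 t : 0 < t -> 0 <= mehler_r t < 1.
Proof. by move=> t0; rewrite expR_ge0/= -expR0 ltr_expR oppr_lt0 mulr_gt0. Qed.

Lemma mehler_w_gt0 t : 0 < t -> 0 < mehler_w t.
Proof. by move=> /mehler_r_lt1/andP[_ ?]; rewrite powR_gt0// subr_gt0. Qed.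

Lemma mehler_wE t : 0 < t -> mehler_w t = (1 - mehler_r t)^-1.
Proof. by move=> /mehler_r_lt1/andP[_ /ltW r1]; rewrite /mehler_w powR_inv1// subr_ge0. Qed.

Lemma gauss_factor_gt0 t x y : 0 < gauss_factor t x y.
Proof. by rewrite !mulr_gt0 ?expR_gt0. Qed.

Lemma hyp_arg_ge0 t x y : 0 <= x ^+ 2 * y ^+ 2 * mehler_r t * mehler_w t ^+ 2.
Proof. by apply: mulr_ge0 (sqr_ge0 _); apply: mulr_ge0 (expR_ge0 _); rewrite mulr_ge0 ?sqr_ge0. Qed.

Lemma hyp_gt0 A z : 0 < A -> 0 <= z -> 0 < hyp A z.
Proof. by move=> A0 z0; apply: lt_le_trans (hyp_ge1 A0 z0). Qed.

Lemma heat_kernel1_gt0 A t x y : 0 < A -> 0 < t -> 0 < heat_kernel1 A t x y.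
Proof.
move=> A0 t0; rewrite mulr_gt0 ?gauss_factor_gt0//.
rewrite !mulr_gt0 ?invr_gt0 ?Gamma_gt0 ?powR_gt0 ?mulr_gt0 ?expR_gt0 ?mehler_w_gt0//.
by apply: hyp_gt0 => //; exact: hyp_arg_ge0.
Qed.

Lemma heat_kernel1_sum nu t x y : -1 < nu -> 0 < t ->
  abs_has_sum (fun k => expR (- t * (4 * k%:R + 2 * nu + 2)) * ell1 nu k x * ell1 nu k y)
    (heat_kernel1 (nu + 1) t x y).
Proof.
move=> nu1 t0; have A0 : 0 < nu + 1 by rewrite -ltrBlDr sub0r.
have r01 := mehler_r_lt1 t0; have w0 := mehler_w_gt0 t0.
have r10 : 0 < 1 - mehler_r t by rewrite subr_gt0; case/andP: r01.
(* Everything in the k-th term that does not depend on [k]; the exponential leaves [mehler_r t ^+ k]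
   and the squared normalisation leaves [k! / (nu + 1)_k], as in [hille_hardy]. *)
pose c := 2 / Gamma (nu + 1) * expR (- (x ^+ 2 / 2)) * expR (- (y ^+ 2 / 2)) *
  expR (- (2 * t * (nu + 1))).
have := abs_has_sumZ c (hille_hardy (x ^+ 2) (y ^+ 2) A0 r01); rewrite addrK.
set s := c * _; have -> : s = heat_kernel1 (nu + 1) t x y.
  rewrite /s /heat_kernel1 /gauss_factor powRM ?expR_ge0 ?(ltW w0)//.
  rewrite -expRM !mulNr.
  have -> : mehler_w t `^ (nu + 1) = (1 - mehler_r t) `^ (- (nu + 1)).
    by rewrite /mehler_w -powRrM mulN1r.
  by rewrite (mehler_wE t0) /c; ring.
apply: eq_abs_has_sum => k.
have p0 := poch_gt0 k A0; have G0 := Gamma_gt0 A0.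
have e0 : 0 <= 2 * Gamma (k%:R + 1) / Gamma (k%:R + nu + 1).
  have g1 : 0 < Gamma (k%:R + 1) :> R by rewrite Gamma_gt0// ltr_wpDl.
  have g2 : 0 < Gamma (k%:R + nu + 1) by rewrite Gamma_gt0// -addrA ltr_wpDl.
  by apply: divr_ge0 (ltW g2); apply: mulr_ge0 (ltW g1).
have E : expR (- t * (4 * k%:R + 2 * nu + 2)) =
    expR (- (2 * t * (nu + 1))) * mehler_r t ^+ k.
  by rewrite /mehler_r -expRM_natl -expRD; congr expR; ring.
have sq : Num.sqrt (2 * Gamma (k%:R + 1) / Gamma (k%:R + nu + 1)) *
   Num.sqrt (2 * Gamma (k%:R + 1) / Gamma (k%:R + nu + 1)) =
   2 * k`!%:R / (Gamma (nu + 1) * poch (nu + 1) k).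
  rewrite -expr2 (sqr_sqrtr e0) Gamma_fact -(Gamma_poch k A0); congr (_ / Gamma _); ring.
rewrite E /ell1 /c.
set q := Num.sqrt _ in sq *.
transitivity (q * q * (expR (- (2 * t * (nu + 1))) * mehler_r t ^+ k *
  ((laguerre nu k).[x ^+ 2] * expR (- (x ^+ 2 / 2))) *
  ((laguerre nu k).[y ^+ 2] * expR (- (y ^+ 2 / 2))))); last by ring.
by rewrite sq; field; rewrite !gt_eqF.
Qed.

(** The eigenvalue is a sum over the coordinates, so each term is a product over them and the
    multiple series factors. *)
Lemma heat_kernelE d (alpha : 'rV[R]_d) t (x y : d.-tuple (measurableTypeR R)) : 0 < t -> (forall i, -1 < alpha 0 i) ->
  heat_kernel alpha t x y =
  \prod_(i < d) heat_kernel1 (alpha 0 i + 1) t (tnth x i) (tnth y i).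
Proof.
move=> t0 a1; rewrite /heat_kernel.
have H := abs_has_sum_bigprod (fun i : 'I_d =>
  heat_kernel1_sum (tnth x i) (tnth y i) (a1 i) t0).
rewrite -(has_sum_summability H); congr (summability.sum _); apply/funext => k.
rewrite /ell !big_split/=; congr (_ * _ * _).
rewrite -expR_sum; congr expR; rewrite -mulr_sumr; congr (_ * _).
rewrite !big_split/= -!mulr_sumr natr_sum; congr (_ + _).
by rewrite sumr_const card_ord mulr_natl mulr2n.
Qed.

Lemma heat_kernel_gt0 d (alpha : 'rV[R]_d) t (x y : d.-tuple (measurableTypeR R)) : 0 < t -> (forall i, -1 < alpha 0 i) ->
  0 < heat_kernel alpha t x y.
Proof.
move=> t0 a1; rewrite heat_kernelE//; apply: prodr_gt0 => i _.
by rewrite heat_kernel1_gt0// -ltrBlDr sub0r.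
Qed.

Lemma powR_interp x lambda : 0 < x -> x `^ lambda * x `^ (1 - lambda) = x.
Proof.
move=> x0; rewrite -powRD ?(gt_eqF x0) ?implybT//.
by rewrite addrC subrK powRr1 ?ltW.
Qed.

(** Splits [H_A] as [H_A^lambda H_A^(1 - lambda)] and compares the factors with [H_B] and [H_G]; the
    powers of [1 + z] cancel. *)
Lemma hyp_interp_le A B G lambda : 0 < A -> 0 < B -> 0 < G -> 0 <= lambda <= 1 ->
  A = lambda * B + (1 - lambda) * G -> exists2 C : R, 0 < C & forall z, 0 <= z ->
  hyp A z <= C * (hyp B z `^ lambda * hyp G z `^ (1 - lambda)).
Proof.
move=> A0 B0 G0 /andP[l0 l1] AE.
have [C1 C10 H1] := hyp_le B0 A0; have [C2 C20 H2] := hyp_le G0 A0.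
exists (C1 `^ lambda * C2 `^ (1 - lambda)) => [|z z0]; first by rewrite mulr_gt0 ?powR_gt0.
have l1' : 0 <= 1 - lambda by rewrite subr_ge0.
have z10 : 0 < 1 + z by rewrite ltr_pwDl.
have HA := hyp_gt0 A0 z0; have HB := hyp_gt0 B0 z0; have HG := hyp_gt0 G0 z0.
rewrite -[leLHS](powR_interp lambda HA).
have h1 : hyp A z `^ lambda <= (C1 * ((1 + z) `^ ((B - A) / 2) * hyp B z)) `^ lambda.
  by rewrite ge0_ler_powR ?nnegrE ?(ltW HA) ?H1// !mulr_ge0 ?powR_ge0 ?(ltW C10) ?(ltW HB).
have h2 : hyp A z `^ (1 - lambda) <= (C2 * ((1 + z) `^ ((G - A) / 2) * hyp G z)) `^ (1 - lambda).
  by rewrite ge0_ler_powR ?nnegrE ?(ltW HA) ?H2// !mulr_ge0 ?powR_ge0 ?(ltW C20) ?(ltW HG).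
apply: le_trans (ler_pM _ _ h1 h2) _; rewrite ?powR_ge0//.
rewrite !powRM ?mulr_ge0 ?powR_ge0 ?(ltW C10) ?(ltW C20) ?(ltW HB) ?(ltW HG)// -!powRrM.
have e : (1 + z) `^ ((B - A) / 2 * lambda) * (1 + z) `^ ((G - A) / 2 * (1 - lambda)) = 1.
  rewrite -powRD ?(gt_eqF z10) ?implybT// -[RHS](powRr0 (1 + z)); congr powR.
  by rewrite AE; field.
by rewrite mulrACA [X in _ * X]mulrACA e mul1r.
Qed.

Lemma hyp_interp_ge A B G lambda : 0 < A -> 0 < B -> 0 < G -> 0 <= lambda <= 1 ->
  A = lambda * B + (1 - lambda) * G -> exists2 C : R, 0 < C & forall z, 0 <= z ->
  hyp B z `^ lambda * hyp G z `^ (1 - lambda) <= C * hyp A z.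
Proof.
move=> A0 B0 G0 /andP[l0 l1] AE.
have [C1 C10 H1] := hyp_le A0 B0; have [C2 C20 H2] := hyp_le A0 G0.
exists (C1 `^ lambda * C2 `^ (1 - lambda)) => [|z z0]; first by rewrite mulr_gt0 ?powR_gt0.
have l1' : 0 <= 1 - lambda by rewrite subr_ge0.
have z10 : 0 < 1 + z by rewrite ltr_pwDl.
have HA := hyp_gt0 A0 z0; have HB := hyp_gt0 B0 z0; have HG := hyp_gt0 G0 z0.
have h1 : hyp B z `^ lambda <= (C1 * ((1 + z) `^ ((A - B) / 2) * hyp A z)) `^ lambda.
  by rewrite ge0_ler_powR ?nnegrE ?(ltW HB) ?H1// !mulr_ge0 ?powR_ge0 ?(ltW C10) ?(ltW HA).
have h2 : hyp G z `^ (1 - lambda) <= (C2 * ((1 + z) `^ ((A - G) / 2) * hyp A z)) `^ (1 - lambda).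
  by rewrite ge0_ler_powR ?nnegrE ?(ltW HG) ?H2// !mulr_ge0 ?powR_ge0 ?(ltW C20) ?(ltW HA).
apply: le_trans (ler_pM _ _ h1 h2) _; rewrite ?powR_ge0//.
rewrite !powRM ?mulr_ge0 ?powR_ge0 ?(ltW C10) ?(ltW C20) ?(ltW HA)// -!powRrM.
have e : (1 + z) `^ ((A - B) / 2 * lambda) * (1 + z) `^ ((A - G) / 2 * (1 - lambda)) = 1.
  rewrite -powRD ?(gt_eqF z10) ?implybT// -[RHS](powRr0 (1 + z)); congr powR.
  by rewrite AE; field.
by rewrite mulrACA [X in _ * X]mulrACA e mul1r powR_interp.
Qed.

Lemma powR_interp_factors (E cB cG D B G hB hG lambda : R) :
  0 < E -> 0 <= cB -> 0 <= cG -> 0 < D -> 0 <= hB -> 0 <= hG ->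
  (E * (cB * D `^ B * hB)) `^ lambda * (E * (cG * D `^ G * hG)) `^ (1 - lambda) =
  E * (cB `^ lambda * cG `^ (1 - lambda) * D `^ (lambda * B + (1 - lambda) * G) *
    (hB `^ lambda * hG `^ (1 - lambda))).
Proof.
move=> E0 cB0 cG0 D0 hB0 hG0.
rewrite !powRM ?mulr_ge0 ?powR_ge0 ?(ltW E0)//.
rewrite mulrACA powR_interp//; congr (_ * _); rewrite mulrACA; congr (_ * _).
rewrite mulrACA; congr (_ * _).
by rewrite -!powRrM (mulrC B) (mulrC G) -powRD// (gt_eqF D0) implybT.
Qed.

(* The parameter enters [heat_kernel1] log-affinely except through [Gamma] and [hyp]. *)
Lemma heat_kernel1_interpE A B G lambda t x y : 0 < B -> 0 < G -> 0 < t ->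
  A = lambda * B + (1 - lambda) * G ->
  heat_kernel1 B t x y `^ lambda * heat_kernel1 G t x y `^ (1 - lambda) =
  gauss_factor t x y * ((2 / Gamma B) `^ lambda * (2 / Gamma G) `^ (1 - lambda) *
    (expR (- (2 * t)) * mehler_w t) `^ A *
    (hyp B (x ^+ 2 * y ^+ 2 * mehler_r t * mehler_w t ^+ 2) `^ lambda *
     hyp G (x ^+ 2 * y ^+ 2 * mehler_r t * mehler_w t ^+ 2) `^ (1 - lambda))).
Proof.
move=> B0 G0 t0 ->; apply: powR_interp_factors.
- exact: gauss_factor_gt0.
- by apply: divr_ge0 => //; exact/ltW/Gamma_gt0.
- by apply: divr_ge0 => //; exact/ltW/Gamma_gt0.
- by apply: mulr_gt0 (expR_gt0 _) (mehler_w_gt0 t0).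
- by apply/ltW/hyp_gt0 => //; exact: hyp_arg_ge0.
- by apply/ltW/hyp_gt0 => //; exact: hyp_arg_ge0.
Qed.

Lemma heat_kernel1_interp_le A B G lambda : 0 < A -> 0 < B -> 0 < G -> 0 <= lambda <= 1 ->
  A = lambda * B + (1 - lambda) * G -> exists2 C : R, 0 < C & forall t x y, 0 < t ->
  heat_kernel1 A t x y <=
  C * (heat_kernel1 B t x y `^ lambda * heat_kernel1 G t x y `^ (1 - lambda)).
Proof.
move=> A0 B0 G0 l01 AE; have [C C0 H] := hyp_interp_le A0 B0 G0 l01 AE.
pose cA := 2 / Gamma A; pose c := (2 / Gamma B) `^ lambda * (2 / Gamma G) `^ (1 - lambda).
have cA0 : 0 < cA by rewrite divr_gt0 ?Gamma_gt0.
have c0 : 0 < c by rewrite mulr_gt0 ?powR_gt0 ?divr_gt0 ?Gamma_gt0.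
(* The [Gamma] factors do not interpolate exactly; the quotient [cA / c] corrects for them. *)
exists (C * cA / c) => [|t x y t0]; first by rewrite divr_gt0// mulr_gt0.
rewrite (heat_kernel1_interpE _ _ B0 G0 t0 AE) /heat_kernel1 -/c -/cA.
set z := _ * mehler_w t ^+ 2; set D := _ `^ A; set h := hyp B _ `^ _ * _.
have -> : C * cA / c * (gauss_factor t x y * (c * D * h)) =
   gauss_factor t x y * (cA * D * (C * h)) by field; rewrite gt_eqF.
rewrite (ler_wpM2l (ltW (gauss_factor_gt0 _ _ _)))// (ler_wpM2l (mulr_ge0 (ltW cA0) (powR_ge0 _ _)))//.
by apply: H; exact: hyp_arg_ge0.
Qed.

Lemma heat_kernel1_interp_ge A B G lambda : 0 < A -> 0 < B -> 0 < G -> 0 <= lambda <= 1 ->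
  A = lambda * B + (1 - lambda) * G -> exists2 C : R, 0 < C & forall t x y, 0 < t ->
  heat_kernel1 B t x y `^ lambda * heat_kernel1 G t x y `^ (1 - lambda) <=
  C * heat_kernel1 A t x y.
Proof.
move=> A0 B0 G0 l01 AE; have [C C0 H] := hyp_interp_ge A0 B0 G0 l01 AE.
pose cA := 2 / Gamma A; pose c := (2 / Gamma B) `^ lambda * (2 / Gamma G) `^ (1 - lambda).
have cA0 : 0 < cA by rewrite divr_gt0 ?Gamma_gt0.
have c0 : 0 < c by rewrite mulr_gt0 ?powR_gt0 ?divr_gt0 ?Gamma_gt0.
exists (C * c / cA) => [|t x y t0]; first by rewrite divr_gt0// mulr_gt0.
rewrite (heat_kernel1_interpE _ _ B0 G0 t0 AE) /heat_kernel1 -/c -/cA.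
set z := _ * mehler_w t ^+ 2; set D := _ `^ A.
have -> : C * c / cA * (gauss_factor t x y * (cA * D * hyp A z)) =
   gauss_factor t x y * (c * D * (C * hyp A z)) by field; rewrite gt_eqF.
rewrite (ler_wpM2l (ltW (gauss_factor_gt0 _ _ _)))// (ler_wpM2l (mulr_ge0 (ltW c0) (powR_ge0 _ _)))//.
by apply: H; exact: hyp_arg_ge0.
Qed.

Lemma powR_prod d (f : 'I_d -> R) lambda : (forall i, 0 <= f i) ->
  (\prod_(i < d) f i) `^ lambda = \prod_(i < d) f i `^ lambda.
Proof.
elim: d f => [|d IH] f f0; first by rewrite !big_ord0 powR1.
by rewrite !big_ord_recl powRM ?prodr_ge0// IH.
Qed.

Lemma heat_kernel_interp d (alpha beta gamma : 'rV[R]_d) lambda :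
  (forall i, -1 < beta 0 i) -> (forall i, -1 < gamma 0 i) -> 0 < lambda < 1 ->
  alpha = lambda *: beta + (1 - lambda) *: gamma ->
  (exists2 C : R, 0 < C & forall t (x y : d.-tuple (measurableTypeR R)), 0 < t ->
     heat_kernel alpha t x y <=
     C * (heat_kernel beta t x y `^ lambda * heat_kernel gamma t x y `^ (1 - lambda))) /\
  (exists2 C : R, 0 < C & forall t (x y : d.-tuple (measurableTypeR R)), 0 < t ->
     heat_kernel beta t x y `^ lambda * heat_kernel gamma t x y `^ (1 - lambda) <=
     C * heat_kernel alpha t x y).
Proof.
move=> b1 g1 /andP[l0 l1] aE.
have B0 i : 0 < beta 0 i + 1 by rewrite -ltrBlDr sub0r.
have G0 i : 0 < gamma 0 i + 1 by rewrite -ltrBlDr sub0r.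
have AE i : alpha 0 i + 1 = lambda * (beta 0 i + 1) + (1 - lambda) * (gamma 0 i + 1).
  by rewrite aE !mxE; ring.
have A0 i : 0 < alpha 0 i + 1 by rewrite AE addr_gt0// mulr_gt0// subr_gt0.
have a1 i : -1 < alpha 0 i by rewrite -sub0r ltrBlDr.
have l01 : 0 <= lambda <= 1 by rewrite !ltW.
have k0 i t x y : 0 < t -> 0 <= heat_kernel1 (alpha 0 i + 1) t x y.
  by move=> t0; exact/ltW/heat_kernel1_gt0.
have kE t (x y : d.-tuple (measurableTypeR R)) : 0 < t ->
    heat_kernel beta t x y `^ lambda * heat_kernel gamma t x y `^ (1 - lambda) =
    \prod_(i < d) (heat_kernel1 (beta 0 i + 1) t (tnth x i) (tnth y i) `^ lambda *
       heat_kernel1 (gamma 0 i + 1) t (tnth x i) (tnth y i) `^ (1 - lambda)).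
  move=> t0; rewrite !heat_kernelE// !powR_prod -?big_split// => i;
  exact/ltW/heat_kernel1_gt0.
split.
  have /choice[C HC] : forall i : 'I_d, exists C : R, 0 < C /\ forall t x y, 0 < t ->
      heat_kernel1 (alpha 0 i + 1) t x y <= C * (heat_kernel1 (beta 0 i + 1) t x y `^ lambda *
        heat_kernel1 (gamma 0 i + 1) t x y `^ (1 - lambda)).
    by move=> i; have [C ? ?] := heat_kernel1_interp_le (A0 i) (B0 i) (G0 i) l01 (AE i); exists C.
  exists (\prod_i C i) => [|t x y t0]; first by apply: prodr_gt0 => i _; case: (HC i).
  rewrite kE// heat_kernelE// -big_split; apply: ler_prod => i _ /=.
  by rewrite k0//=; have [_] := HC i; apply.
have /choice[C HC] : forall i : 'I_d, exists C : R, 0 < C /\ forall t x y, 0 < t ->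
    heat_kernel1 (beta 0 i + 1) t x y `^ lambda * heat_kernel1 (gamma 0 i + 1) t x y `^ (1 - lambda)
    <= C * heat_kernel1 (alpha 0 i + 1) t x y.
  by move=> i; have [C ? ?] := heat_kernel1_interp_ge (A0 i) (B0 i) (G0 i) l01 (AE i); exists C.
exists (\prod_i C i) => [|t x y t0]; first by apply: prodr_gt0 => i _; case: (HC i).
rewrite kE// heat_kernelE// -big_split; apply: ler_prod => i _ /=.
by rewrite mulr_ge0 ?powR_ge0//=; have [_] := HC i; apply.
Qed.

End heat_kernel_closed_form.

(** * Hoelder's inequality *)

(** Weighted arithmetic-geometric mean inequality for [u / a] and [v / b]. With [a] and [b] the
    integrals of the two functions, integrating it gives Hoelder's inequality with constant 1. *)
Lemma young_interp (R : realType) (u v a b lambda : R) : 0 <= u -> 0 <= v -> 0 < a -> 0 < b -> 0 < lambda < 1 ->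
  u `^ lambda * v `^ (1 - lambda) <=
  a `^ lambda * b `^ (1 - lambda) * (lambda / a * u + (1 - lambda) / b * v).
Proof.
move=> u0 v0 a0 b0 /andP[l0 l1]; have l1' : (0 < 1 - lambda)%R by rewrite subr_gt0.
have ua0 : (0 <= u / a)%R by rewrite divr_ge0// ltW.
have vb0 : (0 <= v / b)%R by rewrite divr_ge0// ltW.
have -> : (u `^ lambda * v `^ (1 - lambda) =
   a `^ lambda * b `^ (1 - lambda) * ((u / a) `^ lambda * (v / b) `^ (1 - lambda)))%R.
  rewrite mulrACA -!powRM ?(ltW a0) ?(ltW b0)//.
  by rewrite (mulrC a) (mulrC b) !divfK ?gt_eqF.
rewrite ler_wpM2l ?mulr_ge0 ?powR_ge0//.
have := @conjugate_powR R ((u / a) `^ lambda) ((v / b) `^ (1 - lambda))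
  lambda^-1 (1 - lambda)^-1 (powR_ge0 _ _) (powR_ge0 _ _).
rewrite !invr_gt0 !invrK -!powRrM !mulfV ?gt_eqF// !powRr1// => /(_ l0 l1').
rewrite addrC subrK => /(_ erefl) /le_trans; apply.
by rewrite le_eqVlt; apply/orP; left; apply/eqP; ring.
Qed.

Section hoelder_interpolation.
Local Open Scope ereal_scope.
Context d (T : measurableType d) (R : realType).
Variable mu : {measure set T -> \bar R}.
Implicit Types (f g : T -> \bar R) (D : set T) (lambda : R).

Lemma measurable_poweR_comp D f p : measurable_fun D f ->
  measurable_fun D (fun x => f x `^ p).
Proof. by move=> mf; apply: (measurableT_comp (measurable_poweR p)). Qed.

(** Stated for extended nonnegative functions, since potential kernels may be infinite. Integrals
    equal to 0 or [+oo] are separated off before [young_interp] is integrated. *)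
Lemma hoelder_interp D f g lambda : measurable D -> (0 < lambda < 1)%R ->
  (forall x, D x -> 0 <= f x) -> (forall x, D x -> 0 <= g x) ->
  measurable_fun D f -> measurable_fun D g ->
  \int[mu]_(x in D) (f x `^ lambda * g x `^ (1 - lambda)) <=
  (\int[mu]_(x in D) f x) `^ lambda * (\int[mu]_(x in D) g x) `^ (1 - lambda).
Proof.
move=> mD l01 f0 g0 mf mg; have /andP[l0 l1] := l01.
have l1' : (0 < 1 - lambda)%R by rewrite subr_gt0.
have mfg : measurable_fun D (fun x => f x `^ lambda * g x `^ (1 - lambda)).
  by apply: emeasurable_funM; exact: measurable_poweR_comp.
(* If [h] has integral 0 it vanishes almost everywhere, and so does the product, even where [k] is
   [+oo]. *)
have zero h k p q : (forall x, D x -> 0 <= h x) -> measurable_fun D h -> (0 < p)%R ->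
    measurable_fun D (fun x => h x `^ p * k x `^ q) ->
    \int[mu]_(x in D) h x = 0 -> \int[mu]_(x in D) (h x `^ p * k x `^ q) = 0.
  move=> h0 mh p0 mhk hint.
  have : ae_eq mu D h (cst 0).
    apply/ae_eq_integral_abs => //; rewrite -hint; apply: eq_integral => x /set_mem xD.
    by rewrite gee0_abs// h0.
  move=> hae; rewrite (ae_eq_integral (cst 0))//; first by rewrite integral0.
  apply: filterS hae => x /[apply] ->.
  by rewrite poweR0r ?gt_eqF// mul0e.
have [fi|fi] := eqVneq (\int[mu]_(x in D) f x) 0.
  by rewrite (zero f g) ?mule_ge0 ?poweR_ge0.
have [gi|gi] := eqVneq (\int[mu]_(x in D) g x) 0.
  under eq_integral do rewrite muleC.
  rewrite (zero g f) ?mule_ge0 ?poweR_ge0//.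
  by apply: emeasurable_funM; exact: measurable_poweR_comp.
have fp : 0 < \int[mu]_(x in D) f x by rewrite lt0e fi integral_ge0.
have gp : 0 < \int[mu]_(x in D) g x by rewrite lt0e gi integral_ge0.
(* Both integrals are now positive, so an infinite one makes the right-hand side [+oo]. *)
case Ef : (\int[mu]_(x in D) f x) fp => [a| |]// a0; last first.
  by rewrite poweRyr ?gt_eqF// gt0_mulye ?leey// poweR_gt0.
case Eg : (\int[mu]_(x in D) g x) gp => [b| |]// b0; last first.
  by rewrite poweRyr ?(gt_eqF l1')// gt0_muley ?leey// poweR_gt0.
rewrite !lte_fin in a0 b0.
pose c := (a `^ lambda * b `^ (1 - lambda))%R.
have c0 : (0 < c)%R by rewrite mulr_gt0 ?powR_gt0.
have ca : (0 < c * (lambda / a))%R by rewrite mulr_gt0// divr_gt0.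
have cb : (0 < c * ((1 - lambda) / b))%R by rewrite mulr_gt0// divr_gt0.
apply: (@le_trans _ _ (\int[mu]_(x in D)
  ((c * (lambda / a))%:E * f x + (c * ((1 - lambda) / b))%:E * g x))).
  apply: ge0_le_integral => //.
  - by move=> x Dx; rewrite mule_ge0 ?poweR_ge0.
  - by apply: emeasurable_funD; exact: measurable_funeM.
  - move=> x Dx; have := f0 x Dx; have := g0 x Dx.
    case: (f x) (g x) => [u| |] [v| |]//.
    + move=> v0 u0; rewrite lee_fin in v0; rewrite lee_fin in u0.
      rewrite !poweR_EFin -!EFinM -EFinD lee_fin.
      apply: (le_trans (young_interp u0 v0 a0 b0 l01)); rewrite -/c.
      by rewrite le_eqVlt; apply/orP; left; apply/eqP; ring.
    + by move=> _ u0; rewrite gt0_muley ?lte_fin// addey// leey.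
    + by move=> v0 _; rewrite gt0_muley ?lte_fin// addye// leey.
    + by move=> _ _; rewrite !gt0_muley ?lte_fin// leey.
rewrite ge0_integralD//; last 4 first.
- by move=> x Dx; rewrite mule_ge0 ?f0// lee_fin ltW.
- exact: measurable_funeM.
- by move=> x Dx; rewrite mule_ge0 ?g0// lee_fin ltW.
- exact: measurable_funeM.
rewrite !ge0_integralZl_EFin ?(ltW ca) ?(ltW cb)// Ef Eg !poweR_EFin -!EFinM -EFinD lee_fin.
rewrite -/c le_eqVlt; apply/orP; left; apply/eqP.
by field; rewrite !gt_eqF.
Qed.

End hoelder_interpolation.

(** * Potential kernels and operators *)

Section measurability.
Context {R : realType}.

Lemma measurable_hyp (A : R) : 0 < A -> measurable_fun setT (hyp A).
Proof.
move=> A0; apply: (@measurable_fun_cvg _ _ _ _ (fun n z => series (hyp_term A z) n)).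
  move=> n; apply: measurable_sum => i.
  by apply: measurable_funM => //; exact: exprn_measurable.
by move=> z _; exact: has_sum_series (hyp_abs_has_sum z A0).1.
Qed.

(** The variables are functions on an arbitrary space, so that the lemma serves both [t] alone and
    the pair needed for Tonelli's theorem. *)
Lemma measurable_heat_kernel1 d (T : measurableType d) (A x : R) (t y : T -> R) : 0 < A ->
  measurable_fun setT t -> measurable_fun setT y ->
  measurable_fun setT (fun p => heat_kernel1 A (t p) x (y p)).
Proof.
move=> A0 mt my.
have mexp (f : T -> R) : measurable_fun setT f -> measurable_fun setT (fun p => expR (f p)).
  by move=> mf; apply: (measurableT_comp (@measurable_expR R)).
have mN (f : T -> R) : measurable_fun setT f -> measurable_fun setT (fun p => - f p).
  by move=> mf; apply: (measurableT_comp (@oppr_measurable R setT)).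
have mr : measurable_fun setT (fun p => mehler_r (t p)).
  by apply/mexp/mN; exact: measurable_funM.
have mw : measurable_fun setT (fun p => mehler_w (t p)).
  apply: (measurableT_comp (measurable_powR (-1))).
  by apply: measurable_funB.
have my2 : measurable_fun setT (fun p => y p ^+ 2) by exact: measurable_funX.
apply: measurable_funM.
  apply: measurable_funM; last first.
    by apply/mexp/measurable_funM => //; apply/mN/measurable_funM.
  apply: measurable_funM; last first.
    by apply/mexp/measurable_funM => //; apply/mN/measurable_funM.
  by apply: measurable_funM => //; apply/mexp/mN/measurable_funM.
apply: measurable_funM.
  apply: measurable_funM => //; apply: (measurableT_comp (measurable_powR A)).
  by apply: measurable_funM => //; apply/mexp/mN/measurable_funM.
apply: (measurableT_comp (measurable_hyp A0)).
apply: measurable_funM; last exact: measurable_funX.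
by apply: measurable_funM => //; exact: measurable_funM.
Qed.

(** Valid for all real [t], as Tonelli's theorem on the whole product space demands. *)
Lemma heat_kernel1_ge0 (A t x y : R) : 0 < A -> 0 <= heat_kernel1 A t x y.
Proof.
move=> A0; apply: mulr_ge0; first exact/ltW/gauss_factor_gt0.
apply: mulr_ge0; last by apply/ltW/hyp_gt0 => //; exact: hyp_arg_ge0.
by apply: mulr_ge0 (powR_ge0 _ _); apply: divr_ge0 => //; exact/ltW/Gamma_gt0.
Qed.

Context {d : nat}.
Local Notation T := (d.-tuple (measurableTypeR R)).
Implicit Types (x y : T) (alpha : 'rV[R]_d) (sigma : R).

Definition heat_integral alpha sigma x y : \bar R :=
  (\int[lebesgue_measure]_(t in `]0%R, +oo[) (heat_kernel alpha t x y * t `^ (sigma - 1))%:E)%E.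

Lemma measurable_orthant : measurable (orthant : set T).
Proof.
have -> : orthant = \bigcap_(i in [set: 'I_d]) ((fun y : T => tnth y i : R) @^-1` `]0, +oo[%classic).
  apply/seteqP; split => y /= h i; last by have := h i Logic.I; rewrite /= in_itv/= andbT.
  by move=> _ /=; rewrite in_itv/= andbT; exact: h.
apply: fin_bigcap_measurable => // i _.
rewrite -[X in measurable X]setTI; apply: (@measurable_tnth _ (measurableTypeR R) d i) => //.
Qed.

Lemma measurable_heat_kernel alpha x y : (forall i, -1 < alpha 0 i) ->
  measurable_fun (`]0, +oo[%classic : set R) (fun t : R => heat_kernel alpha t x y).
Proof.
move=> a1.
apply: (eq_measurable_fun (fun t : R =>
    \prod_(i < d) heat_kernel1 (alpha 0 i + 1) t (tnth x i) (tnth y i))).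
  by move=> t /set_mem/=; rewrite in_itv/= andbT => t0; rewrite heat_kernelE.
apply: measurable_prod => i _; apply: measurable_funTS.
by apply: measurable_heat_kernel1 => //; rewrite -ltrBlDr sub0r.
Qed.

Lemma heat_integrand_ge0 alpha sigma x y t : (forall i, -1 < alpha 0 i) -> 0 < t ->
  0 <= heat_kernel alpha t x y * t `^ (sigma - 1).
Proof. by move=> a1 t0; rewrite mulr_ge0 ?powR_ge0// ltW// heat_kernel_gt0. Qed.

Lemma heat_integral_ge0 alpha sigma x y : (forall i, -1 < alpha 0 i) ->
  (0 <= heat_integral alpha sigma x y)%E.
Proof.
move=> a1; apply: integral_ge0 => t /=; rewrite in_itv/= andbT => t0.
by rewrite lee_fin heat_integrand_ge0.
Qed.

Lemma measurable_heat_integral alpha sigma x : (forall i, -1 < alpha 0 i) ->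
  measurable_fun setT (heat_integral alpha sigma x).
Proof.
move=> a1.
(* The closed form agrees with the heat kernel only for [t > 0]; the indicator discards the other
   times. *)
pose f (p : T * measurableTypeR R) : \bar R :=
  (\prod_(i < d) heat_kernel1 (alpha 0 i + 1) p.2 (tnth x i) (tnth p.1 i) *
   (p.2 : R) `^ (sigma - 1) * \1_(`]0, +oo[%classic : set R) p.2)%:E.
have mf : measurable_fun setT f.
  apply/measurable_EFinP; apply: measurable_funM.
    apply: measurable_funM.
      apply: measurable_prod => i _; apply: measurable_heat_kernel1.
      - by rewrite -ltrBlDr sub0r.
      - exact: measurable_snd.
      - apply: (measurableT_comp (@measurable_tnth _ (measurableTypeR R) d i)).
        exact: measurable_fst.
    by apply: (measurableT_comp (measurable_powR (sigma - 1))); exact: measurable_snd.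
  have mI : measurable_fun setT (\1_(`]0, +oo[%classic : set (measurableTypeR R)) : measurableTypeR R -> R).
    exact: measurable_indic.
  exact: (measurableT_comp mI measurable_snd).
have f0 p : (0 <= f p)%E.
  rewrite lee_fin mulr_ge0// mulr_ge0 ?powR_ge0// prodr_ge0// => i _.
  by rewrite heat_kernel1_ge0// -ltrBlDr sub0r.
have := @measurable_fun_fubini_tonelli_F _ _ _ _ R lebesgue_measure f mf f0.
congr (measurable_fun setT _); apply/funext => y.
rewrite /fubini_F /heat_integral [RHS]integral_mkcond; apply: eq_integral => t _.
rewrite patchE /f/= indicE; case: ifPn => tI; rewrite ?mulr1 ?mulr0//.
by rewrite heat_kernelE//; move/set_mem : tI; rewrite /= in_itv/= andbT.
Qed.

End measurability.

Lemma poweR_interpM {R : realType} (a b lambda : R) (u v : \bar R) :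
  0 <= a -> 0 <= b -> (0 <= u -> 0 <= v ->
  (a%:E * u) `^ lambda * (b%:E * v) `^ (1 - lambda) =
  (a `^ lambda * b `^ (1 - lambda))%:E * (u `^ lambda * v `^ (1 - lambda)))%E.
Proof.
move=> a0 b0 u0 v0; rewrite !poweRM ?lee_fin// muleACA.
by rewrite !poweR_EFin -EFinM.
Qed.

Lemma poweR_interp_integrand {R : realType} (K K1 K2 : \bar R) (C f1 f2 m1 m2 lambda : R) :
  0 <= f1 -> 0 <= f2 -> 0 <= m1 -> 0 <= m2 -> (0 <= K1 -> 0 <= K2 ->
  K <= C%:E * (K1 `^ lambda * K2 `^ (1 - lambda)) ->
  K * (f1 `^ lambda * f2 `^ (1 - lambda))%:E * (m1 `^ lambda * m2 `^ (1 - lambda))%:E <=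
  C%:E * ((K1 * f1%:E * m1%:E) `^ lambda * (K2 * f2%:E * m2%:E) `^ (1 - lambda)))%E.
Proof.
move=> f10 f20 m10 m20 K10 K20 HK.
rewrite -[(K1 * _ * _)%E]muleA -[(K2 * _ * _)%E]muleA -2!EFinM (muleC K1) (muleC K2).
rewrite poweR_interpM ?mulr_ge0// (powRM _ f10 m10) (powRM _ f20 m20) mulrACA.
rewrite -[leLHS]muleA -EFinM muleC [leRHS]muleCA.
by apply: lee_wpmul2l => //; rewrite lee_fin mulr_ge0// mulr_ge0 ?powR_ge0.
Qed.

(** * Interpolation of the potentials *)

Section potential_interpolation.
Context {R : realType} {d : nat}.
Local Notation T := (d.-tuple (measurableTypeR R)).
Variables (beta gamma : 'rV[R]_d) (sigma1 sigma2 lambda : R).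
Hypotheses (beta_gt : forall i, -1 < beta 0 i) (gamma_gt : forall i, -1 < gamma 0 i).
Hypotheses (sigma1_gt0 : 0 < sigma1) (sigma2_gt0 : 0 < sigma2) (lambda01 : 0 < lambda < 1).
Let alpha := lambda *: beta + (1 - lambda) *: gamma.
Let sigma := lambda * sigma1 + (1 - lambda) * sigma2.

Let alpha_gt i : -1 < alpha 0 i.
Proof.
have /andP[l0 l1] := lambda01; rewrite !mxE -subr_gt0 opprK.
have -> : lambda * beta 0 i + (1 - lambda) * gamma 0 i + 1 =
  lambda * (beta 0 i + 1) + (1 - lambda) * (gamma 0 i + 1) by ring.
by rewrite addr_gt0// mulr_gt0// ?subr_gt0// -ltrBlDr sub0r.
Qed.

Let sigma_gt0 : 0 < sigma.
Proof. by have /andP[l0 l1] := lambda01; rewrite addr_gt0// mulr_gt0// subr_gt0. Qed.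

Lemma heat_integral_interp : exists2 C : R, 0 < C & forall x y : T,
  (heat_integral alpha sigma x y <= C%:E * (heat_integral beta sigma1 x y `^ lambda *
     heat_integral gamma sigma2 x y `^ (1 - lambda)))%E.
Proof.
have [[C C0 HC] _] := heat_kernel_interp beta_gt gamma_gt lambda01 (erefl alpha).
exists C => // x y.
have mheat (a : 'rV[R]_d) (s : R) : (forall i, -1 < a 0 i) -> measurable_fun (`]0, +oo[%classic : set R)
    (fun t : R => (heat_kernel a t x y * t `^ (s - 1))%:E).
  move=> a1; apply/measurable_EFinP/measurable_funM; first exact: measurable_heat_kernel.
  by apply: measurable_funTS; exact: measurable_powR.
have ge0 (a : 'rV[R]_d) (s : R) : (forall i, -1 < a 0 i) -> forall t : R, `]0, +oo[%classic t ->
    (0 <= (heat_kernel a t x y * t `^ (s - 1))%:E)%E.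
  by move=> a1 t; rewrite /= in_itv/= andbT => t0; rewrite lee_fin heat_integrand_ge0.
have mB := mheat beta sigma1 beta_gt; have mG := mheat gamma sigma2 gamma_gt.
have B0 := ge0 beta sigma1 beta_gt; have G0 := ge0 gamma sigma2 gamma_gt.
have H := hoelder_interp lebesgue_measure (measurable_itv _) lambda01 B0 G0 mB mG.
have CE : (0 <= C%:E)%E by rewrite lee_fin ltW.
apply: le_trans (lee_wpmul2l CE H).
rewrite -ge0_integralZl_EFin ?(ltW C0)//; last 2 first.
- by move=> t _; rewrite mule_ge0 ?poweR_ge0.
- by apply: emeasurable_funM; exact: measurable_poweR_comp.
apply: ge0_le_integral => //.
- exact: ge0.
- exact: mheat.
- by apply: measurable_funeM; apply: emeasurable_funM; exact: measurable_poweR_comp.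
move=> t; rewrite /= in_itv/= andbT => t0.
rewrite -!EFinM lee_fin.
have h (a : 'rV[R]_d) : (forall i, -1 < a 0 i) -> 0 <= heat_kernel a t x y.
  by move=> a1; exact/ltW/heat_kernel_gt0.
rewrite !powRM ?powR_ge0 ?h// -!powRrM.
(* The weights [t^(sigma - 1)] interpolate exactly, so the constant is that of the heat kernel
   estimate. *)
have -> : t `^ (sigma - 1) = t `^ ((sigma1 - 1) * lambda) * t `^ ((sigma2 - 1) * (1 - lambda)).
  by rewrite -powRD ?(gt_eqF t0) ?implybT//; congr powR; rewrite /sigma; ring.
rewrite [X in _ <= _ * X]mulrACA [leRHS]mulrA.
apply: ler_wpM2r; first by rewrite mulr_ge0 ?powR_ge0.
exact: HC.
Qed.

Lemma potential_kernel_ge0 (a : 'rV[R]_d) s (x y : T) : (forall i, -1 < a 0 i) -> 0 < s ->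
  (0 <= potential_kernel a s x y)%E.
Proof.
move=> a1 s0; rewrite mule_ge0 ?heat_integral_ge0// lee_fin invr_ge0.
exact/ltW/Gamma_gt0.
Qed.

Lemma potential_kernel_interp : exists2 C : R, 0 < C & forall x y : T,
  (potential_kernel alpha sigma x y <= C%:E * (potential_kernel beta sigma1 x y `^ lambda *
     potential_kernel gamma sigma2 x y `^ (1 - lambda)))%E.
Proof.
have [C C0 HC] := heat_integral_interp.
(* The interpolated normalisation of the right-hand side; dividing by it restores the constant of
   [heat_integral_interp]. *)
pose g := (Gamma sigma1)^-1 `^ lambda * (Gamma sigma2)^-1 `^ (1 - lambda).
have g0 : 0 < g by rewrite mulr_gt0 ?powR_gt0 ?invr_gt0 ?Gamma_gt0.
have s0 : 0 < (Gamma sigma)^-1 by rewrite invr_gt0 Gamma_gt0.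
exists ((Gamma sigma)^-1 * C / g) => [|x y]; first by apply: divr_gt0 => //; exact: mulr_gt0.
rewrite /potential_kernel -!/(heat_integral _ _ _ _).
have g1 : 0 <= (Gamma sigma1)^-1 by rewrite invr_ge0 ltW ?Gamma_gt0.
have g2 : 0 <= (Gamma sigma2)^-1 by rewrite invr_ge0 ltW ?Gamma_gt0.
rewrite (poweR_interpM _ g1 g2) ?heat_integral_ge0// -/g.
rewrite [leRHS]muleA -EFinM divfK ?gt_eqF// EFinM -[leRHS]muleA.
have S0 : (0 <= (Gamma sigma)^-1%:E)%E by rewrite lee_fin; exact: ltW s0.
exact: (lee_wpmul2l S0 (HC x y)).
Qed.

Lemma mu_density_interp (y : T) : orthant y ->
  mu_density alpha y = mu_density beta y `^ lambda * mu_density gamma y `^ (1 - lambda).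
Proof.
move=> yO; rewrite /mu_density !powR_prod; last 2 first.
- by move=> i; exact: powR_ge0.
- by move=> i; exact: powR_ge0.
rewrite -big_split/=; apply: eq_bigr => i _.
rewrite -!powRrM -powRD ?(gt_eqF (yO i)) ?implybT//.
by congr powR; rewrite !mxE; ring.
Qed.

Lemma measurable_mu_density (a : 'rV[R]_d) : measurable_fun setT (@mu_density R d a).
Proof.
apply: measurable_prod => i _; apply: (measurableT_comp (measurable_powR _)).
exact: measurable_tnth.
Qed.

Lemma mu_density_ge0 (a : 'rV[R]_d) (y : T) : 0 <= mu_density a y.
Proof. by apply: prodr_ge0 => i _; exact: powR_ge0. Qed.

Lemma measurable_potential_integrand (a : 'rV[R]_d) s (f : T -> R) x :
  (forall i, -1 < a 0 i) -> measurable_fun orthant f ->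
  measurable_fun orthant (fun y =>
    (potential_kernel a s x y * (f y)%:E * (mu_density a y)%:E)%E).
Proof.
move=> a1 mf; apply: emeasurable_funM; last first.
  by apply/measurable_EFinP/measurable_funTS; exact: measurable_mu_density.
apply: emeasurable_funM; last exact/measurable_EFinP.
by apply: measurable_funeM; apply: measurable_funTS; exact: measurable_heat_integral.
Qed.

(** The three measures are all written as densities against Lebesgue measure. These interpolate
    exactly on the orthant, so one use of Hoelder's inequality in [y] keeps the constant of the
    kernel estimate. *)
Lemma potential_op_interp : exists2 C : R, 0 < C & forall f1 f2 : T -> R,
  measurable_fun orthant f1 -> measurable_fun orthant f2 ->
  (forall y, orthant y -> 0 <= f1 y) -> (forall y, orthant y -> 0 <= f2 y) ->
  forall x, (potential_op alpha sigma (fun y => f1 y `^ lambda * f2 y `^ (1 - lambda))%R x <=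
    C%:E * (potential_op beta sigma1 f1 x `^ lambda *
            potential_op gamma sigma2 f2 x `^ (1 - lambda)))%E.
Proof.
have [C C0 HC] := potential_kernel_interp.
exists C => // f1 f2 mf1 mf2 f10 f20 x; rewrite /potential_op.
have mO := @measurable_orthant R d.
have mB := measurable_potential_integrand sigma1 x beta_gt mf1.
have mG := measurable_potential_integrand sigma2 x gamma_gt mf2.
have ge0 (a : 'rV[R]_d) (s : R) (f : T -> R) : (forall i, -1 < a 0 i) -> 0 < s -> (forall y, orthant y -> 0 <= f y) ->
    forall y, orthant y -> (0 <= potential_kernel a s x y * (f y)%:E * (mu_density a y)%:E)%E.
  move=> a1 s0 f0 y yO; rewrite mule_ge0// ?lee_fin ?mu_density_ge0//.
  by rewrite mule_ge0 ?potential_kernel_ge0// lee_fin f0.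
have B0 := ge0 beta sigma1 f1 beta_gt sigma1_gt0 f10.
have G0 := ge0 gamma sigma2 f2 gamma_gt sigma2_gt0 f20.
have H := hoelder_interp (tuple_measure lebesgue_measure d) mO lambda01 B0 G0 mB mG.
have CE : (0 <= C%:E)%E by rewrite lee_fin ltW.
apply: le_trans (lee_wpmul2l CE H).
rewrite -ge0_integralZl_EFin ?(ltW C0)//; last 2 first.
- by move=> t _; rewrite mule_ge0 ?poweR_ge0.
- by apply: emeasurable_funM; exact: measurable_poweR_comp.
apply: ge0_le_integral; first exact: mO.
- by apply: ge0 => // y _; rewrite mulr_ge0 ?powR_ge0.
- apply: measurable_potential_integrand => //.
  by apply: measurable_funM; apply: (measurableT_comp (measurable_powR _)).
- by apply: measurable_funeM; apply: emeasurable_funM; exact: measurable_poweR_comp.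
move=> y yO.
rewrite mu_density_interp//; apply: poweR_interp_integrand; rewrite ?mu_density_ge0//.
- exact: f10.
- exact: f20.
- exact: potential_kernel_ge0.
- exact: potential_kernel_ge0.
Qed.

End potential_interpolation.

Unset Implicit Arguments.

Theorem proposition5p1 (R : realType) (d : nat) (beta gamma : 'rV[R]_d)
    (sigma1 sigma2 lambda : R)
    (d_ge1 : (1 <= d)%N)
    (beta_gt : forall i, -1 < beta 0 i) (gamma_gt : forall i, -1 < gamma 0 i)
    (beta_neq_gamma : beta <> gamma)
    (sigma1_gt0 : 0 < sigma1) (sigma2_gt0 : 0 < sigma2)
    (lambda_gt0 : 0 < lambda) (lambda_lt1 : lambda < 1) :
  let alpha := lambda *: beta + (1 - lambda) *: gamma in
  let sigma := lambda * sigma1 + (1 - lambda) * sigma2 in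
  [/\ exists2 C : R, 0 < C & forall (t : R) x y, 0 < t -> orthant x -> orthant y ->
        heat_kernel alpha t x y <=
          C * (heat_kernel beta t x y `^ lambda * heat_kernel gamma t x y `^ (1 - lambda)),
      exists2 C : R, 0 < C & forall (t : R) x y, 0 < t -> orthant x -> orthant y ->
        heat_kernel beta t x y `^ lambda * heat_kernel gamma t x y `^ (1 - lambda) <=
          C * heat_kernel alpha t x y,
      exists2 C : R, 0 < C & forall x y, orthant x -> orthant y ->
        (potential_kernel alpha sigma x y <=
          C%:E * (potential_kernel beta sigma1 x y `^ lambda *
                  potential_kernel gamma sigma2 x y `^ (1 - lambda)))%E &
      exists2 C : R, 0 < C &
        forall f1 f2 : d.-tuple (measurableTypeR R) -> R,
        measurable_fun orthant f1 -> measurable_fun orthant f2 ->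
        (forall y, orthant y -> 0 <= f1 y) ->
        (forall y, orthant y -> 0 <= f2 y) ->
        forall x, orthant x ->
        (potential_op alpha sigma (fun y => f1 y `^ lambda * f2 y `^ (1 - lambda))%R x <=
          C%:E * (potential_op beta sigma1 f1 x `^ lambda *
                  potential_op gamma sigma2 f2 x `^ (1 - lambda)))%E].
Proof.
move=> alpha sigma; have lambda01 : 0 < lambda < 1 by rewrite lambda_gt0.
have [[C1 C10 H1] [C2 C20 H2]] :=
  heat_kernel_interp beta_gt gamma_gt lambda01 (erefl alpha).
have [C3 C30 H3] := potential_kernel_interp beta_gt gamma_gt sigma1_gt0 sigma2_gt0 lambda01.
have [C4 C40 H4] := potential_op_interp beta_gt gamma_gt sigma1_gt0 sigma2_gt0 lambda01.
split.
- by exists C1 => // t x y t0 _ _; exact: H1.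
- by exists C2 => // t x y t0 _ _; exact: H2.
- by exists C3.
- by exists C4 => // f1 f2 mf1 mf2 f10 f20 x _; exact: H4.
Qed.
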